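(* The configuration $C_{\mathfrak m}\in M^6$ is a point of sharp local maximum of the function $D$ (modulo rotations): there is a neighborhood $U$ of $C_{\mathfrak m}$ in $M^6$ such that for every $\mathbf m\in U$ which is not of the form $g\cdot C_{\mathfrak m}$ with $g\in SO(3)$ one has $$D(\mathbf m)<\sqrt{\tfrac{12}{11}}=D(C_{\mathfrak m}).$$
   Context: Let $\mathbb S^2\subset\mathbb R^3$ be the unit sphere centered at the origin and let $M$ be the 3-dimensional manifold of (unoriented) lines tangent to $\mathbb S^2$. A point of $M$ is represented by a pair $(x,\xi)$, $x\in\mathbb S^2$, $\xi$ a unit tangent vector to $\mathbb S^2$ at $x$, with $(x,\xi)$ and $(x,-\xi)$ identified. $M^6$ is the manifold of 6-tuples $\mathbf m=(u_1,\dots,u_6)$ with $u_i\in M$; $SO(3)$ acts on it diagonally. For $u,v\in M$ let $d_{uv}$ be the Euclidean distance between the lines $u$ and $v$, and let $$D(\mathbf m)=\min_{1\le i<j\le 6} d_{u_iu_j}.$$ Coordinates: a point of $\mathbb S^2$ is written $(\varphi,\varkappa)$ with latitude $\varphi\in[-\pi/2,\pi/2]$ and longitude $\varkappa$ (modulo $2\pi$), i.e. it is the point $(\cos\varphi\cos\varkappa,\cos\varphi\sin\varkappa,\sin\varphi)$. For $x\in\mathbb S^2$ different from the poles, $[x,\uparrow_\delta]$ denotes the tangent line at $x$ whose direction is obtained from the unit tangent vector at $x$ pointing North (along the meridian) by the rotation by the angle $\delta$ about the axis from the origin to $x$, counterclockwise when viewed from the tip of $x$. For angles $\varphi,\delta,\varkappa$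 let $C_6(\varphi,\delta,\varkappa)=(A,B,C,D,E,F)$ be the configuration of six tangent lines $$A=[(\varphi,\tfrac{\pi}{6}-\varkappa),\uparrow_\delta],\quad B=[(\varphi,\tfrac{5\pi}{6}-\varkappa),\uparrow_\delta],\quad C=[(\varphi,\tfrac{3\pi}{2}-\varkappa),\uparrow_\delta],$$ $$D=[(-\varphi,\tfrac{\pi}{2}+\varkappa),\uparrow_\delta],\quad E=[(-\varphi,\tfrac{7\pi}{6}+\varkappa),\uparrow_\delta],\quad F=[(-\varphi,\tfrac{11\pi}{6}+\varkappa),\uparrow_\delta].$$ Then $C_{\mathfrak m}=C_6(\varphi_{\mathfrak m},\delta_{\mathfrak m},\varkappa_{\mathfrak m})$ with $$\varphi_{\mathfrak m}=\arcsin\sqrt{\tfrac{3}{11}},\qquad \delta_{\mathfrak m}=\arctan\sqrt{\tfrac{5}{11}},\qquad \varkappa_{\mathfrak m}=-\arctan\tfrac{1}{\sqrt{15}}.$$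
   Formalization: The rotation by δ is taken from North towards East (clockwise when viewed from the tip of x), since with the stated counterclockwise sense the lines A and D are at squared distance about 0.0208, so D(C_m) would not equal √(12/11). *)

(* Defs.v *)
From HB Require Import structures.
From mathcomp Require Import all_boot all_order all_algebra.
From mathcomp Require Import all_classical all_reals all_analysis.
From mathcomp Require Import ring lra.

Set Implicit Arguments.
Unset Strict Implicit.
Unset Printing Implicit Defensive.

Import Order.TTheory GRing.Theory Num.Theory.
Import numFieldNormedType.Exports.

Local Open Scope classical_set_scope.
Local Open Scope ring_scope.
Local Open Scope quotient_scope.

Section Euclidean3.
Context {R : realType}.
Implicit Types (u v w : 'cV[R]_3) (t : R).

Definition vec3 (a b c : R) : 'cV[R]_3 := \col_(i < 3) [:: a; b; c]`_i.

Definition dot u v : R := (u^T *m v) 0 0.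

(* The norm that the library puts on matrices is the sup norm. *)
Definition enorm u : R := Num.sqrt (dot u u).

Definition cross u v : 'cV[R]_3 :=
  vec3 (u 1 0 * v 2 0 - u 2 0 * v 1 0)
       (u 2 0 * v 0 0 - u 0 0 * v 2 0)
       (u 0 0 * v 1 0 - u 1 0 * v 0 0).

(* Rodrigues' formula: for a unit vector x, the rotation by t about the axis
   from 0 to x, right-handed about x. *)
Definition axis_rotation x t v : 'cV[R]_3 :=
  cos t *: v + sin t *: cross x v + ((1 - cos t) * dot x v) *: x.

Lemma dotE u v : dot u v = u 0 0 * v 0 0 + u 1 0 * v 1 0 + u 2 0 * v 2 0.
Proof.
rewrite /dot mxE !big_ord_recl big_ord0 addr0 !mxE addrA.
by congr (_ * _ + u _ _ * v _ _ + u _ _ * v _ _); exact/val_inj.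
Qed.

Lemma vec3E a b c :
  (vec3 a b c 0 0 = a) * (vec3 a b c 1 0 = b) * (vec3 a b c 2 0 = c).
Proof. by rewrite !mxE. Qed.

Lemma enorm1P u : enorm u = 1 <-> dot u u = 1.
Proof.
rewrite /enorm; split=> [e|->]; last exact: sqrtr1.
have /sqr_sqrtr <- : 0 <= dot u u by rewrite dotE -!expr2 !addr_ge0 ?sqr_ge0.
by rewrite e expr1n.
Qed.

Lemma dotNN u : dot (- u) (- u) = dot u u.
Proof. by rewrite !dotE !mxE; ring. Qed.

Lemma dot_rotation x t v : dot x x = 1 ->
  dot (axis_rotation x t v) (axis_rotation x t v) = dot v v.
Proof.
move=> x1; have cs := cos2Dsin2 t; rewrite /axis_rotation.
move: x1 cs; rewrite !dotE !(mxE, vec3E) /= => x1 cs.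
have {}cs : cos t ^+ 2 = 1 - sin t ^+ 2 by rewrite -cs addrK.
set a := x 0 0 in x1 *; set b := x 1 0 in x1 *; set c := x 2 0 in x1 *.
have {}x1 : a * a = 1 - b * b - c * c by rewrite -x1; ring.
by ring: x1 cs.
Qed.

Lemma dot_axis_rotation x t v : dot x x = 1 ->
  dot x (axis_rotation x t v) = dot x v.
Proof.
move=> x1; have -> : dot x (axis_rotation x t v) =
    cos t * dot x v + (1 - cos t) * dot x v * dot x x.
  by rewrite /axis_rotation !dotE !(mxE, vec3E) /=; ring.
by rewrite x1; ring.
Qed.

End Euclidean3.

Section TangentLines.
Variable R : realType.

Definition unit_tangent : set ('cV[R]_3 * 'cV[R]_3) :=
  [set p | [/\ enorm p.1 = 1, enorm p.2 = 1 & dot p.1 p.2 = 0]].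

(* The unit tangent bundle of the sphere, with the subspace topology. *)
Definition UTS2 := set_type unit_tangent.

Definition base (u : UTS2) : 'cV[R]_3 := (val u).1.
Definition dir (u : UTS2) : 'cV[R]_3 := (val u).2.

Definition same_line (u v : UTS2) : bool :=
  (base u == base v) && ((dir u == dir v) || (dir u == - dir v)).

Lemma same_line_refl : reflexive same_line.
Proof. by move=> u; rewrite /same_line !eqxx. Qed.

Lemma same_line_sym : symmetric same_line.
Proof.
move=> u v; rewrite /same_line eq_sym [dir u == dir v]eq_sym.
by rewrite [dir v == - _]eq_sym -eqr_oppLR.
Qed.

Lemma same_line_trans : transitive same_line.
Proof.
move=> v u w; rewrite /same_line => /andP[/eqP-> euv] /andP[/eqP-> evw].
rewrite eqxx /=; case/orP: euv => /eqP ->; case/orP: evw => /eqP ->;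
  by rewrite ?opprK eqxx ?orbT.
Qed.

Canonical same_line_equiv :=
  EquivRel same_line same_line_refl same_line_sym same_line_trans.

Definition M : topologicalType := quotient_topology {eq_quot same_line}.

Definition to_line (u : UTS2) : M := \pi_{eq_quot same_line} u.

Definition of_line (l : M) : UTS2 := repr (l : {eq_quot same_line}).

Lemma of_lineK : cancel of_line to_line.
Proof. by move=> l; rewrite /to_line /of_line reprK. Qed.

Lemma to_lineP u v : reflect (to_line u = to_line v) (same_line u v).
Proof. exact: eqmodP. Qed.

Lemma to_lineK u : same_line (of_line (to_line u)) u.
Proof. by apply/to_lineP; rewrite of_lineK. Qed.

Definition points_of_pair (u : UTS2) : set 'cV[R]_3 :=
  [set base u + t *: dir u | t in [set: R]].

Lemma points_of_pair_same u v :
  same_line u v -> points_of_pair u = points_of_pair v.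
Proof.
rewrite /points_of_pair /same_line => /andP[/eqP bE /orP[]/eqP dE];
  rewrite bE dE //.
by apply/seteqP; split=> _ [t _ <-]; exists (- t) => //=;
  rewrite ?scalerN ?scaleNr ?opprK.
Qed.

Definition points (l : M) : set 'cV[R]_3 := points_of_pair (of_line l).

Lemma points_to_line u : points (to_line u) = points_of_pair u.
Proof. exact/points_of_pair_same/to_lineK. Qed.

Definition line_dist (l l' : M) : R :=
  inf [set enorm (p - q) | p in points l & q in points l'].

Definition SO3 : set 'M[R]_3 := [set g | g^T *m g = 1%:M /\ \det g = 1].

Lemma dot_SO3 (g : SO3) (u v : 'cV[R]_3) :
  dot (val g *m u) (val g *m v) = dot u v.
Proof.
case: g => g gP /=; have [gg _] := set_mem gP.
by rewrite /dot trmx_mul mulmxA -(mulmxA _ _ g) gg mulmx1.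
Qed.

Lemma rotate_subproof (g : SO3) (u : UTS2) :
  (val g *m base u, val g *m dir u) \in unit_tangent.
Proof.
apply/mem_set; case: u => -[x xi] uP; have [/= x1 xi1 o] := set_mem uP.
by split; rewrite /enorm /= dot_SO3.
Qed.

Definition rotate_pair (g : SO3) (u : UTS2) : UTS2 :=
  exist _ (val g *m base u, val g *m dir u) (rotate_subproof g u).

Lemma base_rotate g u : base (rotate_pair g u) = val g *m base u.
Proof. by []. Qed.

Lemma dir_rotate g u : dir (rotate_pair g u) = val g *m dir u.
Proof. by []. Qed.

Definition rotate (g : SO3) (l : M) : M := to_line (rotate_pair g (of_line l)).

Lemma rotate_to_line g u : rotate g (to_line u) = to_line (rotate_pair g u).
Proof.
apply/to_lineP; case/andP: (to_lineK u) => /eqP b /orP d.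
rewrite /same_line !base_rotate !dir_rotate b eqxx /=.
by case: d => /eqP ->; rewrite ?mulmxN eqxx ?orbT.
Qed.

Definition M6 : topologicalType := prod_topology (fun _ : 'I_6 => M).

Definition rotate6 (g : SO3) (m : M6) : M6 := fun i => rotate g (m i).

(* The seed of the iterated minimum is itself one of the fifteen distances. *)
Definition D (m : M6) : R :=
  \big[Num.min/line_dist (m 0) (m 1)]_(ij : 'I_6 * 'I_6 | (ij.1 < ij.2)%N)
     line_dist (m ij.1) (m ij.2).

Definition sphere_point (phi kappa : R) : 'cV[R]_3 :=
  vec3 (cos phi * cos kappa) (cos phi * sin kappa) (sin phi).

(* The derivative of [sphere_point phi kappa] with respect to phi. *)
Definition north (phi kappa : R) : 'cV[R]_3 :=
  vec3 (- (sin phi * cos kappa)) (- (sin phi * sin kappa)) (cos phi).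

(* A positive delta turns North towards East: the sense of rotation is
   counterclockwise for an observer whose line of sight is directed along x,
   away from the origin, whence the minus sign in front of delta (the opposite
   sense gives the mirror image of the tangent line with parameter -delta, and
   the critical configuration below would have two lines at squared distance
   about 0.0208 from each other). *)
Definition tangent_pair (phi kappa delta : R) : 'cV[R]_3 * 'cV[R]_3 :=
  let x := sphere_point phi kappa in
  (x, axis_rotation x (- delta) (north phi kappa)).

Lemma tangent_pair_subproof phi kappa delta :
  tangent_pair phi kappa delta \in unit_tangent.
Proof.
have x1 : dot (sphere_point phi kappa) (sphere_point phi kappa) = 1.
  rewrite dotE !vec3E; move: (cos2Dsin2 phi) (cos2Dsin2 kappa).
  by move=> c1 c2; rewrite -c1 -[cos phi ^+ 2]mulr1 -c2; ring.
have n1 : dot (north phi kappa) (north phi kappa) = 1.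
  rewrite dotE !vec3E; move: (cos2Dsin2 phi) (cos2Dsin2 kappa).
  by move=> c1 c2; rewrite -c1 -[sin phi ^+ 2]mulr1 -c2; ring.
have xn : dot (sphere_point phi kappa) (north phi kappa) = 0.
  rewrite dotE !vec3E; move: (cos2Dsin2 kappa) => c2.
  by rewrite -[sin phi * cos phi]mulr1 -c2; ring.
apply/mem_set; split; rewrite /tangent_pair /=.
- exact/enorm1P.
- by apply/enorm1P; rewrite dot_rotation.
- by rewrite dot_axis_rotation.
Qed.

Definition tangent_line (phi kappa delta : R) : M :=
  to_line (exist _ (tangent_pair phi kappa delta)
                   (tangent_pair_subproof phi kappa delta)).

Definition C6 (phi delta kappa : R) : M6 :=
  tnth [tuple tangent_line phi (pi / 6 - kappa) delta;
              tangent_line phi (5 * pi / 6 - kappa) delta;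
              tangent_line phi (3 * pi / 2 - kappa) delta;
              tangent_line (- phi) (pi / 2 + kappa) delta;
              tangent_line (- phi) (7 * pi / 6 + kappa) delta;
              tangent_line (- phi) (11 * pi / 6 + kappa) delta].

Definition phi_m : R := asin (Num.sqrt (3 / 11)).
Definition delta_m : R := atan (Num.sqrt (5 / 11)).
Definition kappa_m : R := - atan (1 / Num.sqrt 15).

Definition C_m : M6 := C6 phi_m delta_m kappa_m.

End TangentLines.

Arguments unit_tangent R : clear implicits.
Arguments SO3 R : clear implicits.

(* Main.v *)
(* Consider, for each of the twelve pairs of lines at distance sqrt(12/11), its gap
   f = det(x - y, xi, eta)^2 - 12/11 |xi x eta|^2, a polynomial in the base points
   and directions which is nonnegative exactly when the distance is at least
   sqrt(12/11). At C_m the differentials of the gaps, together with those of the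
   constraints h (|x| = 1, |xi| = 1, x.xi = 0), satisfy a single linear relation,
   whose weights lambda on the gaps are positive. Hence C_m is a critical point of
     P = sum f (lambda - f) + sum h (mu - c h),
   and once a rotation has put the first line back in its place this critical
   point is a nondegenerate maximum with value 0. A configuration near C_m without
   pair at distance less than sqrt(12/11) has f >= 0 and h = 0, thus P >= 0, and
   coincides with C_m.

   After rescaling the axes, C_m has coordinates in Z[phi], phi the golden ratio,
   and P has integral coefficients over Z[phi]. So the differential of P at C_m is
   computed exactly, and its Hessian is shown to be negative definite by a
   Cholesky factorization with controlled rounding. *)
Require Import Defs.
From Stdlib Require Import ZArith.
From mathcomp Require Import all_boot all_order all_algebra.
From mathcomp Require Import all_classical all_reals all_analysis.
From mathcomp.zify Require Import ssrZ.
From mathcomp Require Import zify ring lra.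
Import Order.TTheory GRing.Theory Num.Theory.
Import numFieldNormedType.Exports.

Set Implicit Arguments.
Unset Strict Implicit.
Unset Printing Implicit Defensive.

(* The key [Z] designates the scope of [int]. *)
Delimit Scope Z_scope with ZZ.

(** * Second-order jets of polynomials over Z[phi] *)

(* [(a, b)] stands for [a + b phi], where [phi] is the golden ratio. *)
Definition zgold := (Z * Z)%type.
Definition zcst (n : Z) : zgold := (n, 0%ZZ).
Definition zadd (x y : zgold) : zgold := ((x.1 + y.1)%ZZ, (x.2 + y.2)%ZZ).
Definition zmul (x y : zgold) : zgold :=
  ((x.1 * y.1 + x.2 * y.2)%ZZ, (x.1 * y.2 + x.2 * y.1 + x.2 * y.2)%ZZ).
Definition zgold0 (x : zgold) : bool := Z.eqb x.1 0%ZZ && Z.eqb x.2 0%ZZ.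

Inductive expr :=
| Cst of zgold
| Var of nat
| Add of expr & expr
| Mul of expr & expr.

Definition form := seq zgold.
Definition qform := seq (form * form).
(* Value, differential and half the second differential at the origin; the
   quadratic part is kept as a list of products of linear forms. *)
Definition jet := (zgold * form * qform)%type.

Fixpoint form_add (l m : form) : form :=
  match l, m with
  | [::], _ => m
  | _, [::] => l
  | a :: l', b :: m' => zadd a b :: form_add l' m'
  end.
Definition form_scale (c : zgold) (l : form) : form :=
  if zgold0 c then [::] else map (zmul c) l.
Definition qform_scale (c : zgold) (q : qform) : qform :=
  if zgold0 c then [::] else [seq (form_scale c p.1, p.2) | p <- q].
Definition var_form (k : nat) : form := ncons k (zcst 0%ZZ) [:: zcst 1%ZZ].

Definition jadd (j k : jet) : jet :=
  (zadd j.1.1 k.1.1, form_add j.1.2 k.1.2, j.2 ++ k.2).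
Definition jmul (j k : jet) : jet :=
  (zmul j.1.1 k.1.1,
   form_add (form_scale j.1.1 k.1.2) (form_scale k.1.1 j.1.2),
   (j.1.2, k.1.2) :: qform_scale j.1.1 k.2 ++ qform_scale k.1.1 j.2).

Fixpoint jet_of (e : expr) : jet :=
  match e with
  | Cst c => (c, [::], [::])
  | Var k => (zcst 0%ZZ, var_form k, [::])
  | Add a b => jadd (jet_of a) (jet_of b)
  | Mul a b => jmul (jet_of a) (jet_of b)
  end.

(** * Matrices of quadratic forms and a certificate of negative definiteness *)

Definition outer_form (l m : form) : seq form := [seq form_scale a m | a <- l].
Fixpoint mat_add (A B : seq form) : seq form :=
  match A, B with
  | [::], _ => B
  | _, [::] => A
  | a :: A', b :: B' => form_add a b :: mat_add A' B'
  end.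
Definition mat_of (q : qform) : seq form :=
  foldr (fun p A => mat_add (outer_form p.1 p.2) A) [::] q.

(** Two consecutive Fibonacci numbers, the larger one first; their quotient approximates phi with an
    error at most the inverse square of the smaller. *)
Definition fib100 : Z * Z := iter 100 (fun p : Z * Z => ((p.1 + p.2)%ZZ, p.1)) (1%ZZ, 1%ZZ).
Definition ztrunc (x : zgold) : Z := Z.div (x.1 * fib100.2 + x.2 * fib100.1)%ZZ fib100.2.
(* A rational test for [|a + b phi| <= eta], by [|q phi - p| <= 1]. *)
Definition zsmall (eta : Z) (x : zgold) : bool :=
  Z.leb (Z.abs (x.1 * fib100.2 + x.2 * fib100.1) + Z.abs x.2)%ZZ (eta * fib100.2)%ZZ.

(* Rounded Cholesky factorization in fixed point. Nothing is proved about it: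
   only the remainder that it leaves is examined. *)
Fixpoint cholesky (n k : nat) (A : seq (seq Z)) : seq form :=
  match n, A with
  | n'.+1, (a :: r) :: A' =>
    let d := Z.sqrt a in
    let s := [seq Z.div b d | b <- r] in
    (ncons k (zcst 0%ZZ) (map zcst (Z.div a d :: s))) ::
    cholesky n' k.+1
      [seq [seq (p.1 - x.1 * p.2)%ZZ | p <- zip (behead x.2) s] | x <- zip s A']
  | _, _ => [::]
  end.

Definition qform_opp (q : qform) := qform_scale (zcst (-1)%ZZ) q.
Definition form_sq (l : form) : form * form := (l, l).
Definition sq_norm_form (n : nat) (K : Z) : qform :=
  [seq (form_scale (zcst K) (var_form k), var_form k) | k <- iota 0 n].
(** Appending the swapped products doubles the form and makes its matrix symmetric, as [cholesky]
    expects. *)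
Definition remainder (n : nat) (K K' : Z) (q : qform) : seq form :=
  let q1 := qform_scale (zcst (- K)%ZZ) (q ++ [seq (p.2, p.1) | p <- q])
            ++ sq_norm_form n (- K')%ZZ in
  let A1 := mat_of q1 in
  let S := cholesky n 0 [seq mkseq (fun i => ztrunc (nth (zcst 0%ZZ) r i)) n | r <- A1] in
  mat_add A1 (mat_of (qform_opp (map form_sq S))).

(* [- 2 K q] exceeds the sum of [K' (v_0^2 + ... + v_(n-1)^2)] and of squares of
   linear forms by a form whose [n^2] coefficients are at most [eta]. *)
Definition negdef (n : nat) (K K' eta : Z) (q : qform) : bool :=
  let A := remainder n K K' q in
  [&& Z.leb 0 eta, Z.ltb 0 K, Z.ltb (Z.of_nat n * Z.of_nat n * eta)%ZZ K',
   size A <= n & all (fun r => (size r <= n) && all (zsmall eta) r) A].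

Definition strict_max_check n K K' eta e :=
  let: (c, l, q) := jet_of e in
  [&& zgold0 c, all zgold0 l & negdef n K K' eta q].

(** * The Lagrange function *)

(* Row [i] holds the coordinates [x_0, x_1 / sqrt 3, x_2 / sqrt 6] of [sqrt 22]
   times the base point, then of [sqrt 48] times the direction, of the line
   number [i]. *)
Definition Cm_table : seq zgold :=
  [:: (-2,3); (0,1); (1,0);    (0,-3); (2,-1); (2,0);
      (1,-3); (-1,1); (1,0);   (-3,3); (-1,-1); (2,0);
      (1,0); (1,-2); (1,0);    (3,0); (-1,2); (2,0);
      (1,0); (-1,2); (-1,0);   (-3,0); (-1,2); (2,0);
      (1,-3); (1,-1); (-1,0);  (3,-3); (-1,-1); (2,0);
      (-2,3); (0,-1); (-1,0);  (0,3); (2,-1); (2,0)]%ZZ.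

(* The first line is kept fixed; the 30 variables are the increments of the
   coordinates of the other five. *)
Definition evar (k : nat) : expr :=
  Add (Cst (nth (zcst 0) Cm_table k)) (if k < 6 then Cst (zcst 0) else Var (k - 6)).
Definition ebase (i r : nat) : expr := evar (6 * i + r).
Definition edir (i r : nat) : expr := evar (6 * i + (r + 3)).
Definition ecst (n : Z) := Cst (zcst n).
Definition esub a b := Add a (Mul (ecst (-1)%ZZ) b).
(** The Euclidean scalar product up to a constant factor: the weights 3 and 6 undo the division of
    two coordinates by sqrt 3 and sqrt 6. *)
Definition edot (a b : nat -> expr) :=
  Add (Mul (a 0) (b 0)) (Add (Mul (ecst 3) (Mul (a 1) (b 1))) (Mul (ecst 6) (Mul (a 2) (b 2)))).
Definition edet (a b c : nat -> expr) :=
  Add (Mul (a 0) (esub (Mul (b 1) (c 2)) (Mul (b 2) (c 1))))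
  (Add (Mul (a 1) (esub (Mul (b 2) (c 0)) (Mul (b 0) (c 2))))
       (Mul (a 2) (esub (Mul (b 0) (c 1)) (Mul (b 1) (c 0))))).
Definition esq a := Mul a a.
(* Equal to [8448 (det^2 - 12/11 |normal|^2)] on the lines [i] and [j]. *)
Definition egap i j :=
  Add (Mul (ecst 3%ZZ) (esq (edet (fun r => esub (ebase i r) (ebase j r)) (edir i) (edir j))))
   (Add (Mul (ecst 4%ZZ) (esq (edot (edir i) (edir j)))) (ecst (-9216)%ZZ)).
(* The coefficients -1296 and -2688 below are the Lagrange multipliers of the
   constraints; 8192 is any large enough penalty. *)
Definition epenalty (mu : Z) (h : expr) := Mul h (esub (ecst mu) (Mul (ecst 8192) h)).
Definition econstraints i :=
  Add (epenalty (-1296) (Add (edot (ebase i) (ebase i)) (ecst (-22)%ZZ)))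
  (Add (epenalty (-2688) (Add (edot (edir i) (edir i)) (ecst (-48)%ZZ)))
       (epenalty 0 (edot (ebase i) (edir i)))).
(* The twelve pairs at distance [sqrt (12/11)], with the coefficients of the
   only linear relation between the differentials of their gaps. *)
Definition active_pairs : seq (zgold * (nat * nat)) :=
  [seq (zcst 1%ZZ, p) | p <- [:: (0, 1); (0, 2); (1, 2); (3, 4); (3, 5); (4, 5)]] ++
  [seq ((4, 4)%ZZ, p) | p <- [:: (0, 3); (1, 4); (2, 5)]] ++
  [seq ((8, -4)%ZZ, p) | p <- [:: (0, 5); (1, 3); (2, 4)]].
Definition expr_sum := foldr Add (ecst 0%ZZ).
(* Subtracting the squares of the gaps makes the Hessian definite outside the
   common kernel of the differentials, and keeps the gain nonnegative as long as
   the gaps lie between 0 and their weights. *)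
Definition egain (a : zgold * (nat * nat)) :=
  let f := egap a.2.1 a.2.2 in Mul f (esub (Cst a.1) f).
Definition lagrangian : expr :=
  Add (expr_sum (map egain active_pairs)) (expr_sum (map econstraints (iota 1 5))).
(** The factor [2 ^ 40] turns the Hessian into fixed-point numbers large enough for integer square
    roots and quotients. The margin [2 ^ 48] exceeds the total error [30 ^ 2 * 2 ^ 38], as 1024 >
    900. *)
Lemma lagrangian_check : strict_max_check 30 (2 ^ 40) (2 ^ 48) (2 ^ 38) lagrangian.
Proof. by vm_compute. Qed.

Local Open Scope classical_set_scope.
Local Open Scope ring_scope.

(** * Soundness of the second derivative test *)

Section Semantics.
Variable R : realType.
Implicit Types (v : nat -> R) (x y : zgold) (l m : form) (q : qform) (s : R).

Definition Zr (z : Z) : R := (int_of_Z z)%:~R.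

Lemma ZrD a b : Zr (a + b)%ZZ = Zr a + Zr b.
Proof. by rewrite /Zr -rmorphD -raddfD. Qed.
Lemma ZrM a b : Zr (a * b)%ZZ = Zr a * Zr b.
Proof. by rewrite /Zr -rmorphM -rmorphM. Qed.
Lemma ZrN a : Zr (- a)%ZZ = - Zr a.
Proof. by rewrite /Zr -rmorphN -raddfN. Qed.
Lemma Zr0 : Zr 0%ZZ = 0. Proof. by []. Qed.
Lemma Zr1 : Zr 1%ZZ = 1. Proof. by []. Qed.
Lemma Zr_nat n : Zr (Z.of_nat n) = n%:R.
Proof. by rewrite /Zr; have -> : int_of_Z (Z.of_nat n) = n by lia. Qed.
Lemma Zr_le a b : (a <= b)%ZZ -> Zr a <= Zr b.
Proof. by move=> ab; rewrite /Zr ler_int; lia. Qed.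
Lemma Zr_lt a b : (a < b)%ZZ -> Zr a < Zr b.
Proof. by move=> ab; rewrite /Zr ltr_int; lia. Qed.
Lemma Zr_abs a : Zr (Z.abs a) = `|Zr a|.
Proof. by rewrite /Zr -intr_norm; congr (_%:~R); lia. Qed.

Definition golden : R := (1 + Num.sqrt 5) / 2.
Lemma golden2 : golden * golden = golden + 1.
Proof.
have s5 : Num.sqrt 5 * Num.sqrt 5 = 5 :> R by rewrite -expr2 sqr_sqrtr.
by rewrite /golden; field: s5.
Qed.
Lemma golden_gt1 : 1 < golden.
Proof.
have : (1 : R) < Num.sqrt 5 by rewrite -[ltLHS]sqrtr1 ltr_sqrt // ltr1n.
by rewrite /golden; lra.
Qed.

Definition zval x : R := Zr x.1 + Zr x.2 * golden.

Lemma zvalD x y : zval (zadd x y) = zval x + zval y.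
Proof. by rewrite /zval /= !ZrD; ring. Qed.
Lemma zvalM x y : zval (zmul x y) = zval x * zval y.
Proof. by rewrite /zval /= !(ZrD, ZrM); ring: golden2. Qed.
Lemma zval_cst n : zval (zcst n) = Zr n.
Proof. by rewrite /zval /= /Zr; ring. Qed.
Lemma zgold0P x : zgold0 x -> zval x = 0.
Proof. by case: x => a b /andP[/= /Z.eqb_eq -> /Z.eqb_eq ->]; rewrite (zval_cst 0). Qed.

Fixpoint eval v (e : expr) : R :=
  match e with
  | Cst c => zval c
  | Var k => v k
  | Add a b => eval v a + eval v b
  | Mul a b => eval v a * eval v b
  end.

Fixpoint feval v l : R :=
  if l is a :: l' then zval a * v 0%N + feval (v \o succn) l' else 0.
Definition qeval v q : R := \sum_(p <- q) feval v p.1 * feval v p.2.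

Lemma feval_add v l m : feval v (form_add l m) = feval v l + feval v m.
Proof.
elim: l m v => [|a l IH] [|b m] v /=; rewrite ?add0r ?addr0 //.
by rewrite IH zvalD; ring.
Qed.
Lemma feval_scale v c l : feval v (form_scale c l) = zval c * feval v l.
Proof.
rewrite /form_scale; case: ifP => [/zgold0P -> | _]; first by rewrite mul0r.
by elim: l v => [|a l IH] v /=; rewrite ?mulr0 // IH zvalM; ring.
Qed.
Lemma feval_var v k : feval v (var_form k) = v k.
Proof.
elim: k v => [|k IH] v /=; first by rewrite zval_cst /Zr; ring.
by rewrite [X in _ + X]IH zval_cst /Zr /=; ring.
Qed.
Lemma feval0 v l : all zgold0 l -> feval v l = 0.
Proof. by elim: l v => //= a l IH v /andP[/zgold0P -> /IH ->]; rewrite mul0r addr0. Qed.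

Lemma qeval_cat v q q' : qeval v (q ++ q') = qeval v q + qeval v q'.
Proof. exact: big_cat. Qed.
Lemma qeval_cons v p q : qeval v (p :: q) = feval v p.1 * feval v p.2 + qeval v q.
Proof. exact: big_cons. Qed.
Lemma qeval_scale v c q : qeval v (qform_scale c q) = zval c * qeval v q.
Proof.
rewrite /qform_scale; case: ifP => [/zgold0P -> | _]; first by rewrite mul0r /qeval big_nil.
rewrite /qeval big_map mulr_sumr; apply: eq_bigr => p _ /=.
by rewrite feval_scale mulrA.
Qed.

Definition jeval v (j : jet) : R := zval j.1.1 + feval v j.1.2 + qeval v j.2.

(* [F = O(|v|^k)] at the origin. *)
Definition dominated (F : (nat -> R) -> R) (k : nat) :=
  exists2 C, 0 <= C & forall v s, 0 <= s <= 1 ->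
    (forall i, `|v i| <= s) -> `|F v| <= C * s ^+ k.

Lemma dominatedD F G k : dominated F k -> dominated G k ->
  dominated (fun v => F v + G v) k.
Proof.
move=> [C C0 FC] [B B0 GB]; exists (C + B) => [|v s s01 vs]; first exact: addr_ge0.
by rewrite mulrDl (le_trans (ler_normD _ _)) // lerD ?FC ?GB.
Qed.
Lemma dominatedM F G j k : dominated F j -> dominated G k ->
  dominated (fun v => F v * G v) (j + k).
Proof.
move=> [C C0 FC] [B B0 GB]; exists (C * B) => [|v s s01 vs]; first exact: mulr_ge0.
by rewrite exprD mulrACA normrM ler_pM ?FC ?GB.
Qed.
Lemma dominatedW F j k : (j <= k)%N -> dominated F k -> dominated F j.
Proof.
move=> jk [C C0 FC]; exists C => // v s s01 vs; apply: le_trans (FC v s s01 vs) _.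
case/andP: s01 => s0 s1.
by rewrite ler_wpM2l // ler_wiXn2l.
Qed.
Lemma dominated_cst c : dominated (fun=> c) 0.
Proof. by exists `|c| => [|v s _ _]; rewrite ?expr0 ?mulr1. Qed.
Lemma dominated_ext F G k : F =1 G -> dominated F k -> dominated G k.
Proof. by move=> FG [C C0 FC]; exists C => // v s; rewrite -FG; exact: FC. Qed.

Lemma dominated_feval l : dominated (feval^~ l) 1.
Proof.
elim: l => [|a l [C C0 IH]]; first by exists 0 => // v s _ _; rewrite normr0 mul0r.
exists (`|zval a| + C) => [|v s s01 vs /=]; first exact: addr_ge0.
rewrite (mulrDl `|_|) (le_trans (ler_normD _ _)) // lerD ?IH // => [|i]; last exact: vs.
by rewrite normrM expr1 ler_wpM2l ?vs.
Qed.
Lemma dominated_qeval q : dominated (qeval^~ q) 2.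
Proof.
elim: q => [|p q IH]; first by exists 0 => // v s _ _; rewrite /qeval big_nil normr0 mul0r.
apply: dominated_ext (dominatedD (dominatedM (dominated_feval p.1) (dominated_feval p.2)) IH).
by move=> v; rewrite qeval_cons.
Qed.
Lemma dominated_jeval j : dominated (jeval^~ j) 0.
Proof.
apply: dominatedD; last exact: (dominatedW _ (dominated_qeval _)).
by apply: dominatedD; [exact: dominated_cst | exact: (dominatedW _ (dominated_feval _))].
Qed.

(** Taylor's formula with a cubic remainder, by induction on the expression; only products create
    new remainder terms. *)
Lemma jet_ofP e : dominated (fun v => eval v e - jeval v (jet_of e)) 3.
Proof.
elim: e => [c|k|a IHa b IHb|a IHa b IHb].
- exists 0 => // v s _ _; rewrite mul0r /jeval /= /qeval big_nil !addr0 subrr normr0 //.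
- exists 0 => // v s _ _; rewrite mul0r /jeval /= feval_var zval_cst /qeval big_nil.
  by rewrite /Zr add0r addr0 subrr normr0.
- apply: dominated_ext (dominatedD IHa IHb) => v.
  by rewrite /jeval /= zvalD feval_add qeval_cat; ring.
- set ja := jet_of a; set jb := jet_of b.
  (* The terms of degree 3 and 4 in the product of the two jets, which [jmul] drops. *)
  have cross : dominated (fun v => feval v ja.1.2 * qeval v jb.2
      + qeval v ja.2 * feval v jb.1.2 + qeval v ja.2 * qeval v jb.2) 3.
    apply: dominatedD; first apply: dominatedD.
    + exact: (dominatedM (dominated_feval _) (dominated_qeval _)).
    + exact: (dominatedM (dominated_qeval _) (dominated_feval _)).
    + apply: (@dominatedW _ _ 4) => //.
      exact: (dominatedM (dominated_qeval _) (dominated_qeval _)).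
  (* With [a = ja + ra] and [b = jb + rb], the product exceeds [ja jb] by
     [ra jb + ja rb + ra rb]. *)
  have ra := dominatedM IHa (dominated_jeval jb).
  have rb := dominatedM (dominated_jeval ja) IHb.
  have rab := dominatedW (j := 3) (k := 6) isT (dominatedM IHa IHb).
  apply: dominated_ext (dominatedD (dominatedD ra rb) (dominatedD rab cross)) => v.
  rewrite /jeval /= -/ja -/jb zvalM feval_add !feval_scale qeval_cons qeval_cat.
  by rewrite !qeval_scale /=; ring.
Qed.

(** * Bilinear forms given by matrices, and soundness of the definiteness certificate *)

Fixpoint bil u v (A : seq form) : R :=
  if A is r :: A' then u 0%N * feval v r + bil (u \o succn) v A' else 0.

Lemma bil_cons u v r A : bil u v (r :: A) = u 0%N * feval v r + bil (u \o succn) v A.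
Proof. by []. Qed.
Lemma bil_add u v A B : bil u v (mat_add A B) = bil u v A + bil u v B.
Proof.
elim: A B u => [|a A IH] [|b B] u /=; rewrite ?add0r ?addr0 //.
by rewrite IH feval_add; ring.
Qed.
Lemma bil_outer u v l m : bil u v (outer_form l m) = feval u l * feval v m.
Proof.
elim: l u => [|a l IH] u; first by rewrite mul0r.
by rewrite /= IH feval_scale; ring.
Qed.
Lemma bil_mat_of v q : bil v v (mat_of q) = qeval v q.
Proof.
elim: q => [|p q IH]; first by rewrite /qeval big_nil.
by rewrite /= bil_add bil_outer IH qeval_cons.
Qed.

(* Consecutive Fibonacci numbers satisfy [p^2 - p q - q^2 = +-1], which factors
   as [(p - q golden) (p + q (golden - 1))]. *)
Lemma fib100P : `|Zr fib100.1 - Zr fib100.2 * golden| <= 1.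
Proof.
have nrm : (Z.abs (fib100.1 * fib100.1 - fib100.1 * fib100.2 - fib100.2 * fib100.2) = 1)%ZZ.
  by vm_compute.
have f1 : (1 <= fib100.1)%ZZ by apply/Z.leb_le; vm_compute.
have f2 : (0 <= fib100.2)%ZZ by apply/Z.leb_le; vm_compute.
move: (fib100.1) (fib100.2) nrm f1 f2 => p q nrm /Zr_le p1 /Zr_le q0.
have /(congr1 Zr) := nrm.
rewrite Zr_abs -!Z.add_opp_r !(ZrD, ZrN, ZrM).
have -> : Zr p * Zr p + - (Zr p * Zr q) + - (Zr q * Zr q)
          = (Zr p - Zr q * golden) * (Zr p + Zr q * (golden - 1)) by ring: golden2.
(* The product has absolute value 1 and its second factor is at least 1, so the first is at most
   1. *)
rewrite normrM Zr1 => E; rewrite -[leRHS]E ler_peMr //.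
have ph : 0 <= Zr q * (golden - 1) by rewrite mulr_ge0 //; have := golden_gt1; lra.
have := ler_norm (Zr p + Zr q * (golden - 1)).
by rewrite Zr1 in p1; lra.
Qed.

(** Multiplying by [q] turns a + b phi into the integer a q + b p minus b (p - q phi), and the
    latter is at most |b| in absolute value. *)
Lemma zsmallP eta x : zsmall eta x -> `|zval x| <= Zr eta.
Proof.
have f2 : (0 < fib100.2)%ZZ by apply/Z.ltb_lt; vm_compute.
have F := fib100P.
rewrite /zsmall; move: (fib100.1) (fib100.2) f2 F => p q q0 F /Z.leb_le /Zr_le.
move/Zr_lt: q0; rewrite Zr0 => q0.
rewrite !(ZrD, ZrM, Zr_abs) => H; rewrite -(ler_pM2r q0); apply: le_trans H.
have -> : `|zval x| * Zr q = `|zval x * Zr q| by rewrite normrM (gtr0_norm q0).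
have -> : zval x * Zr q = (Zr x.1 * Zr q + Zr x.2 * Zr p)
                          - Zr x.2 * (Zr p - Zr q * golden).
  by rewrite /zval; ring.
rewrite (le_trans (ler_normB _ _)) // lerD2l normrM -[leRHS]mulr1.
by rewrite ler_wpM2l.
Qed.

Lemma feval_small eta v s l : (forall i, `|v i| <= s) -> all (zsmall eta) l ->
  `|feval v l| <= (size l)%:R * (Zr eta * s).
Proof.
move=> vs; elim: l v vs => [|a l IH] v vs /=; first by rewrite normr0 mul0r.
case/andP=> /zsmallP a_eta l_eta; rewrite (le_trans (ler_normD _ _)) //.
rewrite -natr1 (mulrDl _%:R) [leRHS]addrC mul1r lerD ?IH // ?normrM ?ler_pM // => i; exact: vs.
Qed.

Lemma bil_small n eta u v s (A : seq form) : 0 <= s ->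
  (forall i, `|u i| <= s) -> (forall i, `|v i| <= s) -> (0 <= Zr eta) ->
  all (fun r => (size r <= n)%N && all (zsmall eta) r) A ->
  `|bil u v A| <= (size A)%:R * (n%:R * Zr eta * s ^+ 2).
Proof.
move=> s0 us vs eta0; elim: A u us => [|r A IH] u us; first by rewrite normr0 mul0r.
rewrite bil_cons /= => /andP[/andP[rn r_eta] /IH {}IH].
rewrite (le_trans (ler_normD _ _)) // -natr1 (mulrDl _%:R) [leRHS]addrC mul1r lerD ?IH //;
  last by move=> i; exact: us.
rewrite normrM (_ : _ * _ * _ = s * (n%:R * (Zr eta * s))); last by ring.
rewrite ler_pM // (le_trans (feval_small vs r_eta)) // ler_wpM2r ?ler_nat //.
exact: mulr_ge0.
Qed.

Lemma qeval_swap v q : qeval v [seq (p.2, p.1) | p <- q] = qeval v q.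
Proof. by rewrite /qeval big_map; apply: eq_bigr => p _; rewrite mulrC. Qed.
Lemma qeval_norm v n K : qeval v (sq_norm_form n K) = Zr K * \sum_(0 <= i < n) v i ^+ 2.
Proof.
rewrite /qeval /sq_norm_form big_map mulr_sumr /index_iota subn0; apply: eq_bigr => i _ /=.
by rewrite feval_scale feval_var zval_cst; ring.
Qed.
Lemma qeval_opp_sq v (S : seq form) : qeval v (qform_opp (map form_sq S)) <= 0.
Proof.
rewrite /qform_opp qeval_scale zval_cst /qeval big_map (_ : Zr (-1)%ZZ = -1) // mulN1r oppr_le0.
by apply: sumr_ge0 => l _; rewrite /= -expr2 sqr_ge0.
Qed.

(** The remainder is the form [- 2 K q - K' N] minus a sum of squares, where [N] is the squared
    norm, and its absolute value is at most [n ^ 2 eta N]. The squares can be discarded whatever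
    [cholesky] computed, which leaves [- 2 K q >= (K' - n ^ 2 eta) N]. *)
Lemma negdefP n K K' eta q : negdef n K K' eta q ->
  exists2 c : R, 0 < c & forall v, (forall i, (n <= i)%N -> v i = 0) ->
    qeval v q <= - c * \sum_(0 <= i < n) v i ^+ 2.
Proof.
rewrite /negdef /remainder.
set q1 := _ ++ sq_norm_form _ _; set S := cholesky _ _ _; set A := mat_add _ _.
case/and5P=> /Z.leb_le /Zr_le eta0 /Z.ltb_lt /Zr_lt K0 /Z.ltb_lt /Zr_lt.
rewrite !ZrM !Zr_nat => eK' /= An A_eta.
rewrite Zr0 in K0 eta0.
exists ((Zr K' - n%:R * n%:R * Zr eta) / (2 * Zr K)) => [|v vn].
  by rewrite divr_gt0 ?subr_gt0 ?mulr_gt0.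
set N := \sum_(_ <= _ < _) _.
have N0 : 0 <= N by apply: sumr_ge0 => i _; rewrite sqr_ge0.
have vs i : `|v i| <= Num.sqrt N.
  case: (leqP n i) => [/vn ->|ni]; first by rewrite normr0 sqrtr_ge0.
  rewrite -sqrtr_sqr ler_wsqrtr // /N (bigD1_seq i) ?iota_uniq ?mem_index_iota //=.
  by rewrite lerDl sumr_ge0 // => j _; rewrite sqr_ge0.
have := bil_small (sqrtr_ge0 N) vs vs eta0 A_eta.
rewrite /A bil_add !bil_mat_of sqr_sqrtr //.
have := qeval_opp_sq v S.
move: (qeval v (qform_opp _)) => t t0.
rewrite /q1 !qeval_cat qeval_scale qeval_cat qeval_swap qeval_norm -/N zval_cst !ZrN.
have : (size A)%:R * (n%:R * Zr eta * N) <= n%:R * (n%:R * Zr eta * N) :> R.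
  by rewrite ler_wpM2r ?ler_nat // !mulr_ge0.
rewrite ler_norml; move: (size _)%:R => szA H1 /andP[H2 _].
rewrite mulNr mulrAC -mulNr ler_pdivlMr ?mulr_gt0 //.
lra.
Qed.

(** On a vector of Euclidean norm [s] the expression is at most [- b s ^ 2 + C s ^ 3]. Once
    [2 C s <= b], a nonnegative value forces [s = 0]. *)
Lemma strict_max_checkP n K K' eta e : strict_max_check n K K' eta e ->
  exists2 d : R, 0 < d & forall v, (forall i, (n <= i)%N -> v i = 0) ->
    (forall i, `|v i| <= d) -> 0 <= eval v e -> forall i, v i = 0.
Proof.
rewrite /strict_max_check; case jE : (jet_of e) => [[c l] q] /and3P[/zgold0P c0 /feval0 l0].
case/negdefP => b b0 qb; have [C C0 rC] := jet_ofP e.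
have n1 : 0 < n.+1%:R :> R by rewrite ltr0n.
(* A vector with coordinates at most [d] has norm at most [n.+1 * d]: the first bound gives
   [s <= 1], the second [2 (C + 1) s <= b]. The successors keep the denominators positive. *)
exists (Num.min n.+1%:R^-1 (b / (2 * (C + 1) * n.+1%:R))) => [|v vn vd ev].
  by rewrite lt_min invr_gt0 n1 divr_gt0 ?mulr_gt0 // ltr_wpDl.
have {}qb := qb v vn; set N := \sum_(_ <= _ < _) _ in qb.
have N0 : 0 <= N by apply: sumr_ge0 => i _; rewrite sqr_ge0.
have sq_le i : (i < n)%N -> v i ^+ 2 <= N.
  move=> ni; rewrite /N (bigD1_seq i) ?iota_uniq ?mem_index_iota //=.
  by rewrite lerDl sumr_ge0 // => j _; rewrite sqr_ge0.
set s := Num.sqrt N; have s0 : 0 <= s := sqrtr_ge0 N.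
have sN : s ^+ 2 = N by rewrite sqr_sqrtr.
have vs i : `|v i| <= s.
  case: (leqP n i) => [/vn ->|/sq_le ni]; first by rewrite normr0.
  by rewrite -sqrtr_sqr ler_wsqrtr.
have sd d : 0 <= d -> (forall i, `|v i| <= d) -> s <= n.+1%:R * d.
  move=> d0 {}vd; rewrite -(ger0_norm (mulr_ge0 (ltW n1) d0)) -sqrtr_sqr ler_wsqrtr //.
  apply: (@le_trans _ _ (\sum_(0 <= i < n) d ^+ 2)).
    by apply: ler_sum => i _; rewrite -real_normK ?num_real // lerXn2r ?nnegrE.
  rewrite sumr_const_nat subn0 -[leLHS]mulr_natl exprMn ler_wpM2r ?sqr_ge0 //.
  by rewrite -natrX ler_nat; nia.
have s1 : s <= 1.
  have := sd n.+1%:R^-1; rewrite divff ?gt_eqF // invr_ge0 (ltW n1); apply=> // i.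
  by rewrite (le_trans (vd i)) // ge_min lexx.
have sC : 2 * (C * s) <= b.
  apply: (@le_trans _ _ (2 * (C + 1) * s)).
    by rewrite mulrA ler_wpM2r // ler_wpM2l // lerDl.
  rewrite mulrC -ler_pdivlMr ?mulr_gt0 ?ltr_wpDl //.
  have -> : b / (2 * (C + 1)) = n.+1%:R * (b / (2 * (C + 1) * n.+1%:R)).
    move: n1; move: (n.+1%:R) => k k0; field.
    by rewrite !gt_eqF // ltr_wpDl.
  apply: sd => [|i]; first by rewrite ltW // divr_gt0 ?mulr_gt0 // ltr_wpDl.
  by rewrite (le_trans (vd i)) // ge_min lexx orbT.
have := rC v s; rewrite s0 s1 => /(_ isT vs).
rewrite /jeval jE /= c0 l0 !add0r ler_norml => /andP[_ ub].
have Cs : 2 * (C * s ^+ 3) <= b * N.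
  have -> : 2 * (C * s ^+ 3) = 2 * (C * s) * s ^+ 2 by ring.
  by rewrite sN ler_wpM2r.
have {}N0 : N = 0.
  have bN : b * N <= 0 by lra.
  by apply/eqP; rewrite eq_le N0 andbT -(pmulr_rle0 _ b0).
move=> i; apply/eqP; rewrite -normr_le0.
by rewrite (le_trans (vs i)) // /s N0 sqrtr0.
Qed.

Lemma eval_le_near0 e : zgold0 (jet_of e).1.1 ->
  forall b : R, 0 < b -> exists2 d : R, 0 < d & forall v,
    (forall i, `|v i| <= d) -> `|eval v e| <= b.
Proof.
move=> /zgold0P c0 b b0.
have [C C0 eC] : dominated (fun v => eval v e) 1.
  apply: (@dominated_ext (fun v => (eval v e - jeval v (jet_of e))
    + (feval v (jet_of e).1.2 + qeval v (jet_of e).2))).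
    by move=> v; rewrite /jeval c0; ring.
  apply: dominatedD; first exact: (dominatedW _ (jet_ofP e)).
  by apply: dominatedD; [exact: dominated_feval | exact: (dominatedW _ (dominated_qeval _))].
have C1 : 0 < C + 1 by rewrite ltr_wpDl.
exists (Num.min 1 (b / (C + 1))) => [|v vd]; first by rewrite lt_min ltr01 divr_gt0.
set d := Num.min _ _ in vd.
have d0 : 0 <= d := le_trans (normr_ge0 _) (vd 0%N).
have d1 : d <= 1 by rewrite ge_min lexx.
rewrite (le_trans (eC v d _ vd)) ?d0 // expr1.
apply: (@le_trans _ _ ((C + 1) * d)); first by rewrite ler_wpM2r // lerDl.
by rewrite mulrC -ler_pdivlMr // ge_min lexx orbT.
Qed.

End Semantics.

(** * Distance between lines *)

Section LineDistance.
Variable R : realType.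
Implicit Types (a b p q w : 'cV[R]_3) (u v : UTS2 R).

Lemma vec3P a b : a 0 0 = b 0 0 -> a 1 0 = b 1 0 -> a 2 0 = b 2 0 -> a = b.
Proof.
move=> e0 e1 e2; apply/colP => -[[|[|[|//]]] i3].
- by rewrite (_ : Ordinal i3 = 0) //; exact: val_inj.
- by rewrite (_ : Ordinal i3 = 1) //; exact: val_inj.
- by rewrite (_ : Ordinal i3 = 2) //; exact: val_inj.
Qed.

(** By Lagrange's identity, the difference of the two sides is the squared norm of the cross
    product. *)
Lemma cauchy_schwarz a b : dot a b ^+ 2 <= dot a a * dot b b.
Proof.
rewrite -subr_ge0.
have -> : dot a a * dot b b - dot a b ^+ 2 = dot (cross a b) (cross a b).
  by rewrite !dotE !(vec3E, mxE) /=; ring.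
by rewrite dotE -!expr2 !addr_ge0 ?sqr_ge0.
Qed.

(** The vectors [cross b n], [cross n a] and [n] form, up to the factor [dot n n], the dual basis of
    [a], [b], [n]. *)
Lemma cross_basis w a b (n := cross a b) :
  dot n n *: w = dot w (cross b n) *: a + dot w (cross n a) *: b + dot w n *: n.
Proof. by rewrite /n; apply: vec3P; rewrite !dotE !(vec3E, mxE) /=; ring. Qed.

Lemma dotZ (k : R) a : dot (k *: a) (k *: a) = k ^+ 2 * dot a a.
Proof. by rewrite !dotE !mxE; ring. Qed.

Lemma dot_ge0 a : 0 <= dot a a.
Proof. by rewrite dotE -!expr2 !addr_ge0 ?sqr_ge0. Qed.

Definition normal u v := cross (dir u) (dir v).
(** For nonparallel lines, the distance is |offset| divided by the norm of [normal]. *)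
Definition offset u v := dot (base u - base v) (normal u v).

Lemma base_unit u : dot (base u) (base u) = 1.
Proof. by case: u => p uP; have [/enorm1P] := set_mem uP. Qed.
Lemma dir_unit u : dot (dir u) (dir u) = 1.
Proof. by case: u => p uP; have [_ /enorm1P] := set_mem uP. Qed.
Lemma base_dir u : dot (base u) (dir u) = 0.
Proof. by case: u => p uP; have [] := set_mem uP. Qed.

Lemma dot_normal u v : dot (normal u v) (normal u v) = 1 - dot (dir u) (dir v) ^+ 2.
Proof.
rewrite -[1]mulr1 -{1}(dir_unit u) -(dir_unit v) /normal.
by rewrite !dotE !(vec3E, mxE) /=; ring.
Qed.

Lemma offset_points u v p q : points_of_pair u p -> points_of_pair v q ->
  dot (p - q) (normal u v) = offset u v.
Proof.
move=> [t _ <-] [s _ <-]; rewrite /offset /normal.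
by rewrite !dotE !(vec3E, mxE) /=; ring.
Qed.

(** All segments joining the two lines have the same scalar product with the common normal, so
    Cauchy-Schwarz bounds their lengths from below. *)
Lemma le_line_dist u v (c : R) : 0 <= c -> 0 < dot (normal u v) (normal u v) ->
  c ^+ 2 * dot (normal u v) (normal u v) <= offset u v ^+ 2 ->
  c <= line_dist (to_line u) (to_line v).
Proof.
move=> c0 n0 H; rewrite /line_dist !points_to_line; apply: lb_le_inf.
  exists (enorm (base u - base v)); exists (base u).
    by exists 0 => //; rewrite scale0r addr0.
  by exists (base v) => //; exists 0 => //; rewrite scale0r addr0.
move=> _ [p up [q vq <-]]; rewrite /enorm -(ger0_norm c0) -sqrtr_sqr ler_wsqrtr //.
rewrite -(ler_pM2r n0); apply: le_trans H _.
by rewrite -(offset_points up vq) cauchy_schwarz.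
Qed.

(** The infimum is at most the length of the common perpendicular. For parallel lines the normal
    vanishes and the inequality is trivial. *)
Lemma line_dist_le u v (c : R) : 0 <= c -> c <= line_dist (to_line u) (to_line v) ->
  c ^+ 2 * dot (normal u v) (normal u v) <= offset u v ^+ 2.
Proof.
move=> c0; have := dot_ge0 (normal u v); rewrite le_eqVlt => /orP[/eqP <- _|n0 cd].
  by rewrite mulr0 sqr_ge0.
set n := normal u v in n0 *; set w := base u - base v.
(* The parameters of the feet of the common perpendicular: by [cross_basis] they cancel the
   components of [w] along both directions. *)
set t := - dot w (cross (dir v) n) / dot n n.
set s := dot w (cross n (dir u)) / dot n n.
have ld : line_dist (to_line u) (to_line v) <=
    enorm ((base u + t *: dir u) - (base v + s *: dir v)).
  rewrite /line_dist !points_to_line; apply: ge_inf.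
    by exists 0 => _ [p _ [q _ <-]]; exact: sqrtr_ge0.
  by exists (base u + t *: dir u); [exists t | exists (base v + s *: dir v); [exists s|]].
have {}ld := le_trans cd ld.
have E : (base u + t *: dir u) - (base v + s *: dir v) = (offset u v / dot n n) *: n.
  apply: (@scalerI _ _ (dot n n)); first by rewrite gt_eqF.
  rewrite scalerA mulrC divfK ?gt_eqF // /offset -/n -/w.
  have tn : dot n n * t = - dot w (cross (dir v) n) by rewrite mulrC divfK ?gt_eqF.
  have sn : dot n n * s = dot w (cross n (dir u)) by rewrite mulrC divfK ?gt_eqF.
  rewrite opprD addrACA -/w; clearbody w.
  rewrite 2!scalerDr scalerN !scalerA tn sn cross_basis -/(normal u v) -/n scaleNr.
  by rewrite -opprD addrAC subrr add0r.
move: ld; rewrite E /enorm dotZ -[X in X <= _ -> _](ger0_norm c0) -sqrtr_sqr.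
rewrite ler_sqrt ?(mulr_ge0 (sqr_ge0 _) (dot_ge0 _)) // -(ler_pM2r n0) => /le_trans; apply.
by rewrite -mulrA -expr2 -exprMn divfK // gt_eqF.
Qed.

End LineDistance.

(** * Bringing one line back by a rotation *)

Section Gauge.
Variable R : realType.
Implicit Types (a b p q w : 'cV[R]_3) (u v c : UTS2 R).

Lemma mulmx_le m n k (A : 'M[R]_(m, n)) (B : 'M[R]_(n, k)) (a b : R) i j :
  (forall i j, `|A i j| <= a) -> (forall i j, `|B i j| <= b) ->
  `|(A *m B) i j| <= n%:R * (a * b).
Proof.
move=> Aa Bb; rewrite mxE (le_trans (ler_norm_sum _ _ _)) //.
rewrite mulr_natl -[n in leRHS]card_ord -sumr_const ler_sum // => l _.
by rewrite normrM ler_pM.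
Qed.

Lemma coord_le1 p i j : dot p p = 1 -> `|p i j| <= 1.
Proof.
move=> p1; rewrite -(@ler_pXn2r _ 2) ?nnegrE // expr1n real_normK ?num_real //.
rewrite -[leRHS]p1 /dot mxE (bigD1 i) //= mxE ord1 -expr2 lerDl.
by rewrite sumr_ge0 // => l _; rewrite mxE -expr2 sqr_ge0.
Qed.

Definition frame u : 'M[R]_3 :=
  \matrix_(i, j) [:: base u i 0; dir u i 0; cross (base u) (dir u) i 0]`_j.

Lemma det3 (A : 'M[R]_3) : \det A = dot (col 0 A) (cross (col 1 A) (col 2 A)).
Proof.
rewrite (expand_det_col _ 0) dotE !(vec3E, mxE) !big_ord_recl big_ord0.
rewrite /cofactor !(expand_det_row _ 0) !big_ord_recl !big_ord0 /cofactor !det_mx11 !mxE.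
(* The expansions reach the same entry through different ordinals; natural indices let them reduce
   to the same term. *)
pose f (k l : nat) := A (inord k) (inord l).
have Af i j : A i j = f i j by rewrite /f !inord_val.
rewrite !Af; clearbody f; rewrite /= /bump /= ?expr0 ?expr1 ?exprS.
ring.
Qed.

Lemma cross_unit u : dot (cross (base u) (dir u)) (cross (base u) (dir u)) = 1.
Proof.
have -> : dot (cross (base u) (dir u)) (cross (base u) (dir u)) =
  dot (base u) (base u) * dot (dir u) (dir u) - dot (base u) (dir u) ^+ 2.
  by move: (base u) (dir u) => a b; rewrite !dotE !(vec3E, mxE) /=; ring.
by rewrite base_unit dir_unit base_dir; ring.
Qed.

Lemma dot_cross a b : (dot a (cross a b) = 0) * (dot b (cross a b) = 0).
Proof. by split; rewrite !dotE !(vec3E, mxE) /=; ring. Qed.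
Lemma dotC a b : dot a b = dot b a.
Proof. by rewrite !dotE; ring. Qed.

Lemma frame_cols u : (col 0 (frame u) = base u) * (col 1 (frame u) = dir u) *
  (col 2 (frame u) = cross (base u) (dir u)).
Proof. by split; [split|]; apply/colP => i; rewrite !mxE ?ord1. Qed.

Lemma mul_tr_dot (A B : 'M[R]_3) i j : (A^T *m B) i j = dot (col i A) (col j B).
Proof. by rewrite /dot !mxE; apply: eq_bigr => k _; rewrite !mxE. Qed.

Lemma frame_orth u : (frame u)^T *m frame u = 1%:M.
Proof.
apply/matrixP => i j; rewrite mul_tr_dot mxE.
have ord3 (k : 'I_3) : [\/ k = 0, k = 1 | k = 2].
  by case: k => [[|[|[|//]]] k3]; [apply: Or31|apply: Or32|apply: Or33]; exact: val_inj.
by case: (ord3 i) => ->; case: (ord3 j) => ->;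
  rewrite !frame_cols ?base_unit ?dir_unit ?base_dir ?cross_unit ?dot_cross //
    dotC ?base_dir ?dot_cross.
Qed.

Lemma frame_orthr u : frame u *m (frame u)^T = 1%:M.
Proof. exact/mulmx1C/frame_orth. Qed.

Lemma det_frame u : \det (frame u) = 1.
Proof.
rewrite det3 !frame_cols.
have -> : dot (base u) (cross (dir u) (cross (base u) (dir u))) =
  dot (base u) (base u) * dot (dir u) (dir u) - dot (base u) (dir u) ^+ 2.
  by move: (base u) (dir u) => a b; rewrite !dotE !(vec3E, mxE) /=; ring.
by rewrite base_unit dir_unit base_dir; ring.
Qed.

(** Both frames are orthonormal of determinant 1, so this is the rotation that takes the pair [u] to
    the pair [c]. *)
Definition carry u c : 'M[R]_3 := frame c *m (frame u)^T.

Lemma carry_SO3 u c : carry u c \in SO3 R.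
Proof.
apply/mem_set; split; last by rewrite det_mulmx det_tr !det_frame mulr1.
by rewrite /carry trmx_mul trmxK mulmxA -(mulmxA (frame u)) frame_orth mulmx1 frame_orthr.
Qed.

Lemma carryK u c : carry c u *m carry u c = 1%:M.
Proof.
by rewrite /carry mulmxA -(mulmxA (frame u)) frame_orth mulmx1 frame_orthr.
Qed.

Lemma carry_col u c j : carry u c *m col j (frame u) = col j (frame c).
Proof.
by rewrite !colE mulmxA /carry -(mulmxA (frame c)) frame_orth mulmx1.
Qed.

Lemma carry_base u c : carry u c *m base u = base c.
Proof. by have := carry_col u c 0; rewrite !frame_cols. Qed.
Lemma carry_dir u c : carry u c *m dir u = dir c.
Proof. by have := carry_col u c 1; rewrite !frame_cols. Qed.

Definition near_line (d : R) u v :=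
  forall i, `|base u i 0 - base v i 0| < d /\ `|dir u i 0 - dir v i 0| < d.

Lemma mul_sub_le (x y x' y' d : R) : `|x| <= 1 -> `|y'| <= 1 ->
  `|x - x'| <= d -> `|y - y'| <= d -> `|x * y - x' * y'| <= 2 * d.
Proof.
move=> x1 y1 xd yd; have -> : x * y - x' * y' = x * (y - y') + (x - x') * y' by ring.
rewrite (le_trans (ler_normD _ _)) // mulr_natl mulr2n !normrM.
by apply: lerD; [rewrite -[leRHS]mul1r ler_pM | rewrite -[leRHS]mulr1 ler_pM].
Qed.

(** The worst column is the third: its entries are differences of two products, each of which varies
    by at most [2 * d]. *)
Lemma frame_near d u v i j : near_line d u v -> `|frame u i j - frame v i j| <= 4 * d.
Proof.
move=> uv; have b k : `|base u k 0 - base v k 0| <= d by have [/ltW] := uv k.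
have c k : `|dir u k 0 - dir v k 0| <= d by have [_ /ltW] := uv k.
have d0 : 0 <= d := le_trans (normr_ge0 _) (b 0).
have dd : d <= 4 * d by lra.
have xc k l : `|base u k 0 * dir u l 0 - base v k 0 * dir v l 0| <= 2 * d.
  by apply: mul_sub_le => //; apply: coord_le1; [exact: base_unit | exact: dir_unit].
have cc k l k' l' : `|(base u k 0 * dir u l 0 - base u k' 0 * dir u l' 0) -
    (base v k 0 * dir v l 0 - base v k' 0 * dir v l' 0)| <= 4 * d.
  rewrite opprB addrACA [- _ + _]addrC -addrACA.
  by have := xc k l; have := xc k' l'; rewrite !ler_norml => /andP[? ?] /andP[? ?]; lra.
rewrite !mxE; case: j => [[|[|[|//]]] j3] /=; first exact: le_trans (b i) dd.
  exact: le_trans (c i) dd.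
case: i => [[|[|[|//]]] i3] /=; exact: cc.
Qed.

(** Writing [p] as [frame c] times its transpose times [p] makes the difference a product that
    contains [frame u - frame c]. The constant is 3 * 3 * 4: two sums of three terms, and the bound
    [4 * d] of [frame_near]. *)
Lemma carry_near d u c p i : near_line d u c -> dot p p = 1 ->
  `|(carry u c *m p) i 0 - p i 0| <= 36 * d.
Proof.
move=> uc p1.
have -> : (carry u c *m p) i 0 - p i 0 = (frame c *m ((frame u - frame c)^T *m p)) i 0.
  rewrite linearB /= mulmxBl mulmxBr !mulmxA frame_orthr mul1mx.
  by rewrite !mxE.
have -> : 36 * d = 3 * (1 * (3 * (4 * d * 1))) by ring.
apply: mulmx_le => [k l|k l].
  rewrite mxE; case: l => [[|[|[|//]]] l3] /=; apply: coord_le1.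
  - exact: base_unit.
  - exact: dir_unit.
  - exact: cross_unit.
apply: mulmx_le => [k' l'|k' l']; last exact: coord_le1.
by rewrite !mxE -[_ - _]/(_ - _); have := frame_near l' k' uc; rewrite !mxE.
Qed.

End Gauge.

(** * Neighbourhoods in the space of lines *)

Section Topology.
Variable R : realType.
Implicit Types (u v c : UTS2 R).

Lemma reverse_subproof u : (base u, - dir u) \in unit_tangent R.
Proof.
apply/mem_set; split; rewrite ?enorm1P /= ?dotNN ?base_unit ?dir_unit //.
by have := base_dir u; rewrite !dotE !mxE => H; rewrite -[RHS]oppr0 -H; ring.
Qed.
Definition reverse u : UTS2 R := exist _ (base u, - dir u) (reverse_subproof u).

Lemma base_reverse u : base (reverse u) = base u. Proof. by []. Qed.
Lemma dir_reverse u : dir (reverse u) = - dir u. Proof. by []. Qed.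

Lemma base_continuous : continuous (@base R).
Proof. by move=> u; apply: continuous_comp; [exact: initial_continuous | exact: cvg_fst]. Qed.
Lemma dir_continuous : continuous (@dir R).
Proof. by move=> u; apply: continuous_comp; [exact: initial_continuous | exact: cvg_snd]. Qed.

Definition line_nbhs (d : R) c : set (M R) :=
  [set l | exists2 u, l = to_line u & near_line d u c].

Lemma near_lineE d u c : 0 < d ->
  near_line d u c <-> ball (base c) d (base u) /\ ball (dir c) d (dir u).
Proof.
move=> d0; split=> [H|[[_ Hb] [_ Hd]] i].
  by split; split=> // i j; rewrite ord1 /ball /= distrC; have [] := H i.
by move: (Hb i 0) (Hd i 0); rewrite /ball /= distrC => b; rewrite distrC.
Qed.

Lemma open_near_line d c : 0 < d -> open [set u | near_line d u c].
Proof.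
move=> d0; have -> : [set u | near_line d u c] =
    @base R @^-1` ball (base c) d `&` @dir R @^-1` ball (dir c) d.
  by apply/seteqP; split=> u /=; rewrite near_lineE.
by apply: openI; apply: open_comp => [u _|];
  [exact: base_continuous|exact: ball_open|exact: dir_continuous|exact: ball_open].
Qed.

Lemma near_line_reverse d u c : near_line d (reverse u) c <-> near_line d u (reverse c).
Proof.
by split=> H i; have [b e] := H i; split=> //; move: e;
  rewrite dir_reverse !mxE -normrN opprD opprK // addrC.
Qed.

Lemma to_line_reverse u : to_line (reverse u) = to_line u.
Proof. by apply/to_lineP; rewrite /same_line /base /dir /= !eqxx orbT. Qed.

(** In the quotient topology openness is tested on the preimage, which is the union of the pairs
    near [c] and those near [reverse c]. *)
Lemma nbhs_line d c : 0 < d -> nbhs (to_line c) (line_nbhs d c).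
Proof.
move=> d0; apply: open_nbhs_nbhs; split; last first.
  by exists c => // i; rewrite !subrr normr0.
suff E : @to_line R @^-1` line_nbhs d c =
    [set u | near_line d u c] `|` [set u | near_line d u (reverse c)].
  by rewrite /open /= /quotient_open -/(@to_line R) E; apply: openU; exact: open_near_line.
apply/seteqP; split=> u /=.
  move=> [v /to_lineP /andP[/eqP uv /orP[]/eqP duv] vc].
    by left; move=> i; rewrite uv duv.
  by right; apply/near_line_reverse => i; rewrite base_reverse dir_reverse uv duv opprK.
case=> [uc|/near_line_reverse uc]; first by exists u.
by exists (reverse u) => //; rewrite to_line_reverse.
Qed.

(** There are finitely many indices, so conditions on each projection can be imposed together. *)
Lemma nbhs_lines d (c : 'I_6 -> UTS2 R) : 0 < d ->
  nbhs ((fun i => to_line (c i)) : M6 R) [set m | forall i, line_nbhs d (c i) (m i)].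
Proof.
move=> d0.
apply: (@filter_forall _ _ (fun i (m : M6 R) => line_nbhs d (c i) (m i)) _
  (nbhs_filter _)) => i.
exact: (@proj_continuous _ (fun=> M R) i _ _ (nbhs_line (c i) d0)).
Qed.

End Topology.

(** * Coordinates of the configuration *)

Section Coordinates.
Variable R : realType.
Implicit Types (u v c : UTS2 R) (y : nat -> UTS2 R).
Local Notation s3 := (Num.sqrt 3 : R).
Local Notation s5 := (Num.sqrt 5 : R).
Local Notation s6 := (Num.sqrt 6 : R).
Local Notation s22 := (Num.sqrt 22 : R).
Local Notation s48 := (Num.sqrt 48 : R).

Definition line_coord u (r : nat) : R :=
  match r with
  | 0 => s22 * base u 0 0
  | 1 => s22 * base u 1 0 / s3
  | 2 => s22 * base u 2 0 / s6
  | 3 => s48 * dir u 0 0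
  | 4 => s48 * dir u 1 0 / s3
  | _ => s48 * dir u 2 0 / s6
  end.

Lemma sqrt_nat n : (Num.sqrt n%:R : R) * Num.sqrt n%:R = n%:R.
Proof. by rewrite -expr2 sqr_sqrtr. Qed.

Lemma sqrt_gt0 n : (0 < n)%N -> 0 < (Num.sqrt n%:R : R).
Proof. by move=> n0; rewrite sqrtr_gt0 ltr0n. Qed.

Lemma sqrtE (a b : R) : 0 <= b -> b * b = a -> Num.sqrt a = b.
Proof. by move=> b0 <-; rewrite -expr2 sqrtr_sqr ger0_norm. Qed.

Lemma sin_atan (x : R) : sin (atan x) = x * cos (atan x).
Proof.
have c0 : cos (atan x) != 0.
  by rewrite gt_eqF // cos_gt0_pihalf // atan_gtNpi2 atan_ltpi2.
by rewrite -[LHS](divfK c0) -/(tan _) atanK.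
Qed.

Lemma sqrt_bound : -1 <= Num.sqrt (3 / 11 : R) <= 1.
Proof.
have -> : -1 <= Num.sqrt (3 / 11 : R) by have := sqrtr_ge0 (3 / 11 : R); lra.
by rewrite -[leRHS]sqrtr1 ler_wsqrtr //; lra.
Qed.

Lemma sin_phi : sin (phi_m R) = s6 / s22.
Proof.
have r : Num.sqrt (3 / 11) = s6 / s22.
  apply: sqrtE; first by rewrite divr_ge0 ?sqrtr_ge0.
  by rewrite mulf_div !sqrt_nat; field.
by rewrite /phi_m asinK // in_itv /= sqrt_bound.
Qed.

Lemma cos_phi : cos (phi_m R) = 4 / s22.
Proof.
rewrite /phi_m cos_asin ?sqrt_bound // sqr_sqrtr; last by lra.
apply: sqrtE; first by rewrite divr_ge0 ?sqrtr_ge0.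
by rewrite mulf_div !sqrt_nat; field.
Qed.

Lemma cos_delta : cos (delta_m R) = Num.sqrt 11 / 4.
Proof.
rewrite /delta_m cos_atan sqr_sqrtr; last by lra.
rewrite -[RHS]invf_div; congr (_^-1).
apply: sqrtE; first by rewrite divr_ge0 ?sqrtr_ge0.
by rewrite mulf_div !sqrt_nat; field.
Qed.

Lemma sin_delta : sin (delta_m R) = s5 / 4.
Proof.
rewrite /delta_m sin_atan -/(delta_m R) cos_delta.
have -> : Num.sqrt (5 / 11) = s5 / Num.sqrt 11 :> R.
  apply: sqrtE; first by rewrite divr_ge0 ?sqrtr_ge0.
  by rewrite mulf_div !sqrt_nat.
by rewrite mulrA divfK // gt_eqF // sqrt_gt0.
Qed.

Lemma sqrt15 : Num.sqrt 15 = s3 * s5.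
Proof.
apply: sqrtE; first by rewrite mulr_ge0 ?sqrtr_ge0.
by rewrite mulrACA !sqrt_nat -natrM.
Qed.

Lemma cos_kappa : cos (kappa_m R) = s3 * s5 / 4.
Proof.
rewrite /kappa_m cosN cos_atan -[RHS]invf_div; congr (_^-1).
apply: sqrtE; first by rewrite divr_ge0 ?mulr_ge0 ?sqrtr_ge0.
by rewrite -sqrt15 expr2 !mulf_div !sqrt_nat; field.
Qed.

Lemma sin_kappa : sin (kappa_m R) = - (1 / 4).
Proof.
have := cos_kappa; rewrite /kappa_m cosN sinN sin_atan => ->.
by rewrite sqrt15; field; rewrite !gt_eqF ?sqrt_gt0.
Qed.

(** The triplication formula at pi / 2 gives [3 s - 4 s ^ 3 = 1], that is
    [(s + 1) (2 s - 1) ^ 2 = 0], and [s] is positive. *)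
Lemma sin_pi6 : sin (pi / 6) = 1 / 2 :> R.
Proof.
have := sin_pihalf R; rewrite (_ : pi / 2 = pi / 6 + (pi / 6 + pi / 6)); last by field.
rewrite !(sinD, cosD); have := cos2Dsin2 (pi / 6 : R).
have : 0 < sin (pi / 6 : R).
  by apply: sin_gt0_pi; have := pi_gt0 R; lra.
move: (sin _) (cos _) => s c s0 cs E.
have : (s + 1) * (2 * s - 1) ^+ 2 = 0.
  have c2 : c ^+ 2 = 1 - s ^+ 2 by rewrite -cs addrK.
  have {}E : 3 * s * c ^+ 2 - s ^+ 3 = 1 by apply: etrans E; ring.
  have -> : (s + 1) * (2 * s - 1) ^+ 2 = 1 - (3 * s * (1 - s ^+ 2) - s ^+ 3) by ring.
  by rewrite -c2 E subrr.
move/eqP; rewrite mulf_eq0 expf_eq0 /= => /orP[/eqP|/eqP]; lra.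
Qed.

Lemma cos_pi6 : cos (pi / 6) = s3 / 2.
Proof.
have c0 : 0 < cos (pi / 6 : R).
  by apply: cos_gt0_pihalf; have := pi_gt0 R; lra.
have := cos2Dsin2 (pi / 6 : R); rewrite sin_pi6 => E.
have := @sqrtE (3 / 4) _ (ltW c0); rewrite -expr2 => <-; last by lra.
apply: sqrtE; first by rewrite divr_ge0 ?sqrtr_ge0.
by rewrite mulf_div !sqrt_nat; field.
Qed.

Definition Cm_pair (i : nat) : UTS2 R :=
  let tp (a b c : R) := exist _ (tangent_pair a b c) (tangent_pair_subproof a b c) : UTS2 R in
  match i with
  | 0 => tp (phi_m R) (pi / 6 - kappa_m R) (delta_m R)
  | 1 => tp (phi_m R) (5 * pi / 6 - kappa_m R) (delta_m R)
  | 2 => tp (phi_m R) (3 * pi / 2 - kappa_m R) (delta_m R)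
  | 3 => tp (- phi_m R) (pi / 2 + kappa_m R) (delta_m R)
  | 4 => tp (- phi_m R) (7 * pi / 6 + kappa_m R) (delta_m R)
  | _ => tp (- phi_m R) (11 * pi / 6 + kappa_m R) (delta_m R)
  end.

Lemma C_mE (i : 'I_6) : C_m R i = to_line (Cm_pair i).
Proof.
by rewrite /C_m /C6 (tnth_nth (C_m R 0)); case: i => [[|[|[|[|[|[|//]]]]]] i6].
Qed.

(** Reduced to pi / 6 and [kappa_m], the cosines lie in Q(sqrt 5) and the sines in sqrt 3 times that
    field. This is why rescaling the axes gives coordinates in Z[phi]. *)
Lemma longitudes : let k := kappa_m R in
  [/\ (cos (pi / 6 - k) = (3 * golden R - 2) / 4) * (sin (pi / 6 - k) = s3 * golden R / 4),
      (cos (5 * pi / 6 - k) = (1 - 3 * golden R) / 4) *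
        (sin (5 * pi / 6 - k) = s3 * (golden R - 1) / 4),
      (cos (3 * pi / 2 - k) = 1 / 4) * (sin (3 * pi / 2 - k) = s3 * (1 - 2 * golden R) / 4) &
   [/\ (cos (pi / 2 + k) = 1 / 4) * (sin (pi / 2 + k) = s3 * (2 * golden R - 1) / 4),
      (cos (7 * pi / 6 + k) = (1 - 3 * golden R) / 4) *
        (sin (7 * pi / 6 + k) = s3 * (1 - golden R) / 4) &
      (cos (11 * pi / 6 + k) = (3 * golden R - 2) / 4) *
        (sin (11 * pi / 6 + k) = s3 * (- golden R) / 4)]].
Proof.
move=> k.
have E1 : 5 * pi / 6 - k = pi - (pi / 6 + k) by field.
have E2 : 3 * pi / 2 - k = pi + pi / 2 - k by field.
have E3 : 7 * pi / 6 + k = (pi / 6 + k) + pi by field.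
have E4 : 11 * pi / 6 + k = pi + pi - (pi / 6 - k) by field.
have s3s3 := sqrt_nat 3; have s5s5 := sqrt_nat 5.
have ck := cos_kappa; have sk := sin_kappa; rewrite E1 E2 E3 E4 -/k in ck sk *.
clearbody k.
rewrite !(cosB, sinB, cosD, sinD, cospi, sinpi, cos_pihalf, sin_pihalf) !cos_pi6 !sin_pi6.
rewrite !ck !sk /golden.
by do !split; field: s3s3 s5s5.
Qed.

(** The sign [e] of the latitude treats northern and southern lines together; [X] and [Y] are the
    rescaled cosine and sine of the longitude. *)
Lemma line_coord_tangent f k u (e X Y : R) (r : nat) :
  val u = tangent_pair f k (delta_m R) -> e * e = 1 ->
  cos f = 4 / s22 -> sin f = e * s6 / s22 -> cos k = X / 4 -> sin k = s3 * Y / 4 ->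
  (r < 6)%N -> line_coord u r =
  [:: X; Y; e; - 3 * (e * X + s5 * Y) / 4; (s5 * X - 3 * e * Y) / 4; 2]`_r.
Proof.
move=> uE ee cf sf ck sk r6.
have E22 : s22 = Num.sqrt 2 * Num.sqrt 11 by rewrite -sqrtrM // -natrM.
have E6 : s6 = Num.sqrt 2 * s3 by rewrite -sqrtrM // -natrM.
have E48 : s48 = 4 * s3.
  by apply: sqrtE; rewrite ?mulr_ge0 ?sqrtr_ge0 // mulrACA sqrt_nat; ring.
have XY : X * X = 16 - 3 * (Y * Y).
  have := cos2Dsin2 k; rewrite ck sk !expr2 => E.
  have s3s3 := sqrt_nat 3; have -> : X * X = 16 * (X / 4 * (X / 4)) by field.
  by rewrite -[X / 4 * _](addrK (s3 * Y / 4 * (s3 * Y / 4))) E; field: s3s3.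
have nz n : (0 < n)%N -> Num.sqrt (n%:R : R) != 0 by move=> n0; rewrite gt_eqF ?sqrt_gt0.
have := nz 2 isT; have := nz 3 isT; have := nz 11 isT.
have := sqrt_nat 2; have := sqrt_nat 3; have := sqrt_nat 11.
rewrite /line_coord /base /dir uE /tangent_pair /axis_rotation /= dotE !mxE /= cosN sinN.
move: cf sf; rewrite ck sk cos_delta sin_delta E48 E22 E6.
move: s3 s5 (Num.sqrt 2) (Num.sqrt 11) => r3 r5 r2 r11 -> -> q11 q3 q2 n11 n3 n2.
by case: r r6 => [|[|[|[|[|[|//]]]]]] _ /=;
  field: q11 q3 q2 ee XY; rewrite ?n2 ?n3 ?n11.
Qed.

End Coordinates.

(** * Rigidity *)

Section Rigidity.
Variable R : realType.
Implicit Types (u v c : UTS2 R) (y : nat -> UTS2 R).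
Local Notation s3 := (Num.sqrt 3 : R).
Local Notation s5 := (Num.sqrt 5 : R).
Local Notation s6 := (Num.sqrt 6 : R).
Local Notation s22 := (Num.sqrt 22 : R).
Local Notation s48 := (Num.sqrt 48 : R).

Lemma Zr_pos p : Zr R (Z.pos p) = (Pos.to_nat p)%:R.
Proof. by rewrite -Zr_nat positive_nat_Z. Qed.
Lemma Zr_neg p : Zr R (Z.neg p) = - (Pos.to_nat p)%:R.
Proof. by rewrite -Zr_pos -ZrN. Qed.

Lemma Zr_lit : (Zr R 1%ZZ = 1) * (Zr R 3%ZZ = 3) * (Zr R 4%ZZ = 4) *
  (Zr R 6%ZZ = 6) * (Zr R 8%ZZ = 8) * (Zr R (-4)%ZZ = -4) * (Zr R (-1)%ZZ = -1) *
  (Zr R (-22)%ZZ = -22) * (Zr R (-48)%ZZ = -48) * (Zr R (-9216)%ZZ = -9216).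
Proof.
by do !split; rewrite ?Zr_neg ?Zr_pos; do ?congr (- _); congr (_%:R); lia.
Qed.

Lemma evalC (w : nat -> R) (c : zgold) : eval w (Cst c) = zval R c. Proof. by []. Qed.
Lemma evalD (w : nat -> R) (a b : expr) : eval w (Add a b) = eval w a + eval w b.
Proof. by []. Qed.
Lemma evalM (w : nat -> R) (a b : expr) : eval w (Mul a b) = eval w a * eval w b.
Proof. by []. Qed.

(** Functions dominated by a positive power vanish at the origin, so only the constant of the jet
    survives. Exact values at [C_m] are thus obtained by computation. *)
Lemma eval0 e : eval (fun=> 0 : R) e = zval R (jet_of e).1.1.
Proof.
have zero F k : (0 < k)%N -> dominated F k -> F (fun=> 0 : R) = 0.
  case: k => // k _ [C _ /(_ (fun=> 0) 0)]; rewrite lexx ler01 expr0n mulr0 => H.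
  by apply/eqP; rewrite -normr_le0 H // => i; rewrite normr0.
apply/eqP; rewrite -subr_eq0; apply/eqP.
rewrite -[RHS](zero _ 3%N isT (jet_ofP R e)) /jeval.
by rewrite (zero _ 1%N isT (dominated_feval _ _)) (zero _ 2%N isT (dominated_qeval _ _)) !addr0.
Qed.

Lemma eval_sum (w : nat -> R) es : eval w (expr_sum es) = \sum_(e <- es) eval w e.
Proof. by elim: es => [|e es IH]; rewrite ?big_nil ?big_cons -?IH /= ?zval_cst. Qed.

Lemma Cm_pair_coord i r : (i < 6)%N -> (r < 6)%N ->
  line_coord (Cm_pair R i) r = zval R (nth (zcst 0) Cm_table (6 * i + r)).
Proof.
have [kA kB kC [kD kE kF]] := longitudes R.
have s5E : s5 = 2 * golden R - 1 by rewrite /golden; field.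
have one : 1 * 1 = 1 :> R by rewrite mul1r.
have mone : -1 * -1 = 1 :> R by rewrite mulrNN mul1r.
have sinN_phi : sin (- phi_m R) = - 1 * s6 / s22 by rewrite sinN sin_phi mulN1r mulNr.
have sin_phi' : sin (phi_m R) = 1 * s6 / s22 by rewrite mul1r sin_phi.
have cosN_phi : cos (- phi_m R) = 4 / s22 by rewrite cosN cos_phi.
have north_line k X Y (u : UTS2 R) := @line_coord_tangent R (phi_m R) k u 1 X Y.
have south_line k X Y (u : UTS2 R) := @line_coord_tangent R (- phi_m R) k u (-1) X Y.
have g2 := golden2 R.
have to_nat : (Pos.to_nat 1 = 1%N) * (Pos.to_nat 2 = 2%N) * (Pos.to_nat 3 = 3%N) by [].
case: i => [|[|[|[|[|[|//]]]]]] _ r6.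
- rewrite (north_line (pi / 6 - kappa_m R) _ _ (Cm_pair R 0) r erefl one (cos_phi R) sin_phi'
    kA.1 kA.2 r6) s5E.
  by case: r r6 => [|[|[|[|[|[|//]]]]]] _;
    rewrite /zval /= ?Zr0 ?Zr_pos ?Zr_neg ?to_nat; field: g2.
- rewrite (north_line (5 * pi / 6 - kappa_m R) _ _ (Cm_pair R 1) r erefl one (cos_phi R) sin_phi'
    kB.1 kB.2 r6) s5E.
  by case: r r6 => [|[|[|[|[|[|//]]]]]] _;
    rewrite /zval /= ?Zr0 ?Zr_pos ?Zr_neg ?to_nat; field: g2.
- rewrite (north_line (3 * pi / 2 - kappa_m R) _ _ (Cm_pair R 2) r erefl one (cos_phi R) sin_phi'
    kC.1 kC.2 r6) s5E.
  by case: r r6 => [|[|[|[|[|[|//]]]]]] _;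
    rewrite /zval /= ?Zr0 ?Zr_pos ?Zr_neg ?to_nat; field: g2.
- rewrite (south_line (pi / 2 + kappa_m R) _ _ (Cm_pair R 3) r erefl mone cosN_phi sinN_phi
    kD.1 kD.2 r6) s5E.
  by case: r r6 => [|[|[|[|[|[|//]]]]]] _;
    rewrite /zval /= ?Zr0 ?Zr_pos ?Zr_neg ?to_nat; field: g2.
- rewrite (south_line (7 * pi / 6 + kappa_m R) _ _ (Cm_pair R 4) r erefl mone cosN_phi sinN_phi
    kE.1 kE.2 r6) s5E.
  by case: r r6 => [|[|[|[|[|[|//]]]]]] _;
    rewrite /zval /= ?Zr0 ?Zr_pos ?Zr_neg ?to_nat; field: g2.
- rewrite (south_line (11 * pi / 6 + kappa_m R) _ _ (Cm_pair R 5) r erefl mone cosN_phi sinN_phi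
    kF.1 kF.2 r6) s5E.
  by case: r r6 => [|[|[|[|[|[|//]]]]]] _;
    rewrite /zval /= ?Zr0 ?Zr_pos ?Zr_neg ?to_nat; field: g2.
Qed.

Definition config_coord y k := line_coord (y (k %/ 6)%N) (k %% 6)%N.

Lemma config_coordE y i r : (r < 6)%N -> config_coord y (6 * i + r) = line_coord (y i) r.
Proof.
by move=> r6; rewrite /config_coord mulnC divnMDl // modnMDl divn_small // addn0 modn_small.
Qed.

(** The shift by 6 skips the first line; the value 0 from index 30 on is what [strict_max_checkP]
    asks for. *)
Definition disp y k : R :=
  if (k < 30)%N then config_coord y (k + 6) - zval R (nth (zcst 0) Cm_table (k + 6)) else 0.

Definition anchored y := forall r, (r < 6)%N ->
  line_coord (y 0%N) r = zval R (nth (zcst 0) Cm_table r).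

Lemma eval_evar y k : anchored y -> (k < 36)%N -> eval (disp y) (evar k) = config_coord y k.
Proof.
move=> y0 k36; rewrite /evar /=; case: ltnP => k6 /=.
  by rewrite zval_cst addr0 -y0 // -config_coordE // add0n.
by rewrite /disp ltn_subLR // k36 subnK // subrKC.
Qed.

Lemma eval_evec y i r : anchored y -> (i < 6)%N -> (r < 6)%N ->
  eval (disp y) (evar (6 * i + r)) = line_coord (y i) r.
Proof. by move=> y0 i6 r6; rewrite eval_evar ?config_coordE //; lia. Qed.

Lemma sqrt_neq0 n : (0 < n)%N -> Num.sqrt (n%:R : R) != 0.
Proof. by move=> n0; rewrite gt_eqF ?sqrt_gt0. Qed.

Lemma dir_coord u v :
  let p r := line_coord u (r + 3) in let q r := line_coord v (r + 3) in
  p 0%N * q 0%N + (3 * (p 1%N * q 1%N) + 6 * (p 2%N * q 2%N)) = 48 * dot (dir u) (dir v).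
Proof.
have := sqrt_nat R 3; have := sqrt_nat R 6; have := sqrt_nat R 48.
have := sqrt_neq0 (n := 3) isT; have := sqrt_neq0 (n := 6) isT.
rewrite /line_coord /= dotE; move: (dir u) (dir v) s3 s6 s48 => a b r3 r6 r48 n6 n3 q48 q6 q3.
by field: q48 q6 q3; rewrite ?n3 ?n6.
Qed.

Lemma offset_coord u v :
  let x r := line_coord u r - line_coord v r in
  let p r := line_coord u (r + 3) in let q r := line_coord v (r + 3) in
  x 0%N * (p 1%N * q 2%N - p 2%N * q 1%N) + (x 1%N * (p 2%N * q 0%N - p 0%N * q 2%N)
     + x 2%N * (p 0%N * q 1%N - p 1%N * q 0%N)) = s22 * s48 * s48 / (s3 * s6) * offset u v.
Proof.
have := sqrt_neq0 (n := 3) isT; have := sqrt_neq0 (n := 6) isT.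
rewrite /line_coord /= /offset /normal dotE.
move: (base u) (base v) (dir u) (dir v) s3 s6 s48 s22 => a b p q r3 r6 r48 r22 n6 n3.
by rewrite !(vec3E, mxE) /=; field; rewrite ?n3 ?n6.
Qed.

Lemma norm_coord u :
  let p r := line_coord u r in let q r := line_coord u (r + 3) in
  [/\ p 0%N * p 0%N + (3 * (p 1%N * p 1%N) + 6 * (p 2%N * p 2%N)) = 22,
      q 0%N * q 0%N + (3 * (q 1%N * q 1%N) + 6 * (q 2%N * q 2%N)) = 48 &
      p 0%N * q 0%N + (3 * (p 1%N * q 1%N) + 6 * (p 2%N * q 2%N)) = 0].
Proof.
move=> p q; split; last 2 first.
- by rewrite dir_coord dir_unit mulr1.
- transitivity (s22 * s48 * dot (base u) (dir u)); last by rewrite base_dir mulr0.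
  have := sqrt_nat R 3; have := sqrt_nat R 6.
  have := sqrt_neq0 (n := 3) isT; have := sqrt_neq0 (n := 6) isT.
  rewrite /p /q /line_coord /= dotE.
  move: (base u) (dir u) s3 s6 s48 s22 => a b r3 r6 r48 r22 n6 n3 q6 q3.
  by field: q6 q3; rewrite ?n3 ?n6.
transitivity (22 * dot (base u) (base u)); last by rewrite base_unit mulr1.
have := sqrt_nat R 3; have := sqrt_nat R 6; have := sqrt_nat R 22.
have := sqrt_neq0 (n := 3) isT; have := sqrt_neq0 (n := 6) isT.
rewrite /p /line_coord /= dotE.
move: (base u) s3 s6 s22 => a r3 r6 r22 n6 n3 q22 q6 q3.
by field: q22 q6 q3; rewrite ?n3 ?n6.
Qed.

Lemma eval_dir y i j : anchored y -> (i < 6)%N -> (j < 6)%N ->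
  eval (disp y) (edot (edir i) (edir j)) = 48 * dot (dir (y i)) (dir (y j)).
Proof.
move=> y0 i6 j6.
have ev k r : (k < 6)%N -> (r < 6)%N -> eval (disp y) (evar (6 * k + r)) = line_coord (y k) r.
  exact: eval_evec.
by rewrite /edot /ecst /edir !(ev, evalD, evalM, evalC) // !zval_cst !Zr_lit dir_coord.
Qed.

Lemma eval_gap y i j : anchored y -> (i < 6)%N -> (j < 6)%N ->
  eval (disp y) (egap i j) = 8448 * (offset (y i) (y j) ^+ 2
    - 12 / 11 * dot (normal (y i) (y j)) (normal (y i) (y j))).
Proof.
move=> y0 i6 j6.
have ev k r : (k < 6)%N -> (r < 6)%N -> eval (disp y) (evar (6 * k + r)) = line_coord (y k) r.
  exact: eval_evec.
rewrite /egap /edet /edot /esub /esq /ecst /ebase /edir !(ev, evalD, evalM, evalC) // !zval_cst.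
rewrite !Zr_lit.
transitivity (3 * (s22 * s48 * s48 / (s3 * s6) * offset (y i) (y j)) ^+ 2
  + (4 * (48 * dot (dir (y i)) (dir (y j))) ^+ 2 - 9216)).
  by rewrite -offset_coord -dir_coord; ring.
rewrite dot_normal; move: (offset _ _) (dot _ _) => o d.
have := sqrt_nat R 3; have := sqrt_nat R 6; have := sqrt_nat R 22; have := sqrt_nat R 48.
have := sqrt_neq0 (n := 3) isT; have := sqrt_neq0 (n := 6) isT.
move: s3 s6 s22 s48 => r3 r6 r22 r48 n6 n3 q48 q22 q6 q3.
by field: q48 q22 q6 q3; rewrite ?n3 ?n6.
Qed.

Lemma eval_penalty (w : nat -> R) mu h : eval w h = 0 -> eval w (epenalty mu h) = 0.
Proof. by move=> h0; rewrite /epenalty evalM h0 mul0r. Qed.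

Lemma eval_constraints y i : anchored y -> (i < 6)%N -> eval (disp y) (econstraints i) = 0.
Proof.
move=> y0 i6; have [nx nu xu] := norm_coord (y i).
have ev r : (r < 6)%N -> eval (disp y) (evar (6 * i + r)) = line_coord (y i) r.
  exact: eval_evec.
rewrite /econstraints !(evalD, eval_penalty) ?addr0 //;
  rewrite /edot /ecst /ebase /edir !(ev, evalD, evalM, evalC) // !zval_cst !Zr_lit.
- exact: xu.
- by move: nu => /= ->; rewrite subrr.
- by move: nx => /= ->; rewrite subrr.
Qed.

Lemma evals_le_near0 (T : eqType) (F : T -> expr) (r : seq T) (b : R) : 0 < b ->
  all (fun a => zgold0 (jet_of (F a)).1.1) r ->
  exists2 d : R, 0 < d & forall w, (forall i, `|w i| <= d) ->
    forall a, a \in r -> eval w (F a) <= b.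
Proof.
move=> b0; elim: r => [|a r IH] /=; first by exists 1.
case/andP=> /eval_le_near0 /(_ b b0) [d d0 dF] /IH [e e0 eF].
exists (Num.min d e) => [|w wd a']; first by rewrite lt_min d0.
rewrite inE => /orP[/eqP -> | a'r].
  rewrite (le_trans (ler_norm _)) // dF // => i.
  by rewrite (le_trans (wd i)) // ge_min lexx.
by apply: eF => // i; rewrite (le_trans (wd i)) // ge_min lexx orbT.
Qed.

Lemma active_pairs_gap0 : all (fun a => [&& (a.2.1 < a.2.2)%N, (a.2.2 < 6)%N &
  zgold0 (jet_of (egap a.2.1 a.2.2)).1.1]) active_pairs.
Proof. by vm_compute. Qed.

(** Gaps in [0, 1] then stay below their weights, which makes each [egain] nonnegative. The least
    weight is 8 - 4 phi, whence the bound on [4 * golden R]. *)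
Lemma active_pairs_weight a : a \in active_pairs -> 1 <= zval R a.1.
Proof.
have g1 := golden_gt1 R; have g2 := golden2 R.
have g3 : 4 * golden R <= 7 by nra.
have : all (fun a => a.1 \in [:: zcst 1; (4, 4); (8, -4)]%ZZ) active_pairs by vm_compute.
move/allP => /[apply]; rewrite !inE => /or3P[] /eqP ->; rewrite /zval /=.
- by rewrite Zr1 Zr0; lra.
- by rewrite Zr_lit; lra.
- by rewrite !Zr_lit; lra.
Qed.

Lemma rigid : exists2 d : R, 0 < d & forall y, anchored y ->
  (forall k, `|disp y k| <= d) ->
  (forall i j, (i < j < 6)%N ->
    12 / 11 * dot (normal (y i) (y j)) (normal (y i) (y j)) <= offset (y i) (y j) ^+ 2) ->
  forall k, disp y k = 0.
Proof.
have [d1 d1_0 max] := strict_max_checkP R lagrangian_check.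
have zero : all (fun a => zgold0 (jet_of (egap a.2.1 a.2.2)).1.1) active_pairs.
  by apply: sub_all active_pairs_gap0 => a /and3P[].
have [d2 d2_0 sm] := evals_le_near0 ltr01 zero.
(* Within [d1] the Lagrange function has a strict maximum; within [d2] all active gaps are at most
   1. *)
exists (Num.min d1 d2) => [|y y0 yd far]; first by rewrite lt_min d1_0.
apply: max => [k k30|k|].
- by rewrite /disp ltnNge k30.
- by apply: le_trans (yd k) _; rewrite ge_min lexx.
rewrite /lagrangian evalD 2!eval_sum.
have -> : \sum_(e <- map econstraints (iota 1 5)) eval (disp y) e = 0.
  rewrite big_map; apply: big1_seq => i /andP[_]; rewrite mem_iota => /andP[_ i6].
  exact: (eval_constraints y0 i6).
rewrite addr0 big_map big_seq; apply: sumr_ge0 => a aP; rewrite /egain /esub /ecst.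
have /and3P[lt12 lt6 _] := allP active_pairs_gap0 a aP.
have gap1 : eval (disp y) (egap a.2.1 a.2.2) <= 1.
  by apply: (sm _ _ a aP) => k; apply: le_trans (yd k) _; rewrite ge_min lexx orbT.
clear sm zero; have gap0 : 0 <= eval (disp y) (egap a.2.1 a.2.2).
  rewrite (eval_gap y0 (ltn_trans lt12 lt6) lt6); apply: mulr_ge0; first exact: ler0n.
  by rewrite subr_ge0; apply: far; rewrite lt12.
rewrite evalM evalD evalM 2!evalC zval_cst Zr_lit mulN1r.
have a1 := active_pairs_weight aP; apply: mulr_ge0 gap0 _; rewrite subr_ge0.
exact: le_trans gap1 a1.
Qed.

End Rigidity.

(** * Comparison of configurations with [C_m], and invariance under rotations *)

Section Configurations.
Variable R : realType.
Implicit Types (u v c : UTS2 R) (y : nat -> UTS2 R).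

Lemma UTS2P u v : base u = base v -> dir u = dir v -> u = v.
Proof.
move=> bE dE; apply: val_inj; rewrite [LHS]surjective_pairing [RHS]surjective_pairing.
by congr (_, _).
Qed.

Lemma line_coord_inj u v : (forall r, (r < 6)%N -> line_coord u r = line_coord v r) -> u = v.
Proof.
move=> E; have n k (k0 : (0 < k)%N) := sqrt_neq0 R k0.
have eqN (k x z : R) : k != 0 -> k * x = k * z -> x = z by move=> /mulfI; apply.
have eqV (k x z : R) : k != 0 -> x / k = z / k -> x = z.
  by move=> k0; apply: mulIf; rewrite invr_eq0.
apply: UTS2P; apply: vec3P.
- by apply: (eqN _ _ _ (n 22 isT)); exact: (E 0%N).
- by apply: (eqN _ _ _ (n 22 isT)); apply: (eqV _ _ _ (n 3 isT)); exact: (E 1%N).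
- by apply: (eqN _ _ _ (n 22 isT)); apply: (eqV _ _ _ (n 6 isT)); exact: (E 2%N).
- by apply: (eqN _ _ _ (n 48 isT)); exact: (E 3%N).
- by apply: (eqN _ _ _ (n 48 isT)); apply: (eqV _ _ _ (n 3 isT)); exact: (E 4%N).
- by apply: (eqN _ _ _ (n 48 isT)); apply: (eqV _ _ _ (n 6 isT)); exact: (E 5%N).
Qed.

(** The factors sqrt 22 and sqrt 48 are at most 7, and dividing by sqrt 3 or sqrt 6 only shrinks. *)
Lemma line_coord_near u v (d : R) r :
  (forall i, `|base u i 0 - base v i 0| <= d) ->
  (forall i, `|dir u i 0 - dir v i 0| <= d) ->
  `|line_coord u r - line_coord v r| <= 7 * d.
Proof.
move=> bd dd.
have lip (k : R) : 0 <= k <= 49 -> forall x z, `|x - z| <= d ->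
    `|Num.sqrt k * x - Num.sqrt k * z| <= 7 * d.
  move=> /andP[k0 k49] x z xz; rewrite -mulrBr normrM; apply: ler_pM => //.
  rewrite ger0_norm ?sqrtr_ge0 // -[leRHS](ger0_norm (ler0n _ _)) -sqrtr_sqr ler_wsqrtr //.
  by rewrite -natrX.
have lipV (k : R) : 1 <= k -> forall x z, `|x - z| <= 7 * d ->
    `|x / Num.sqrt k - z / Num.sqrt k| <= 7 * d.
  move=> k1 x z xz; rewrite -mulrBl normrM -[leRHS]mulr1; apply: ler_pM => //.
  by rewrite ger0_norm ?invr_ge0 ?sqrtr_ge0 // invf_le1 ?sqrtr_gt0 -?[leLHS]sqrtr1 ?ler_wsqrtr //;
    lra.
have n22 : 0 <= (22 : R) <= 49 by lra.
have n48 : 0 <= (48 : R) <= 49 by lra.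
have n3 : (1 : R) <= 3 by lra.
have n6 : (1 : R) <= 6 by lra.
rewrite /line_coord; case: r => [|[|[|[|[|r]]]]].
- exact: lip.
- by apply: lipV => //; apply: lip.
- by apply: lipV => //; apply: lip.
- exact: lip.
- by apply: lipV => //; apply: lip.
- by apply: lipV => //; apply: lip.
Qed.

Lemma disp_diff y k : (k < 30)%N ->
  disp y k = line_coord (y ((k + 6) %/ 6)%N) ((k + 6) %% 6)%N -
             line_coord (Cm_pair R ((k + 6) %/ 6)) ((k + 6) %% 6)%N.
Proof.
move=> k30; have d6 : ((k + 6) %/ 6 < 6)%N by lia.
rewrite /disp k30 /config_coord (Cm_pair_coord R d6 (ltn_pmod _ _)) //.
by have -> : (6 * ((k + 6) %/ 6) + (k + 6) %% 6 = k + 6)%N by lia.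
Qed.

Lemma anchoredP y : y 0%N = Cm_pair R 0 -> anchored y.
Proof. by move=> y0 r r6; rewrite y0 Cm_pair_coord. Qed.

Lemma disp_eq0 y : y 0%N = Cm_pair R 0 -> (forall k, disp y k = 0) ->
  forall i, (i < 6)%N -> y i = Cm_pair R i.
Proof.
move=> y0 dE [|i] i6 //; apply: line_coord_inj => r r6.
have k30 : (6 * i + r < 30)%N by lia.
have := dE (6 * i + r)%N; rewrite disp_diff // => /eqP; rewrite subr_eq0.
have -> : ((6 * i + r + 6) %/ 6 = i.+1)%N by lia.
have -> : ((6 * i + r + 6) %% 6 = r)%N by lia.
by move/eqP.
Qed.

Lemma disp_Cm_pair : disp (Cm_pair R) = (fun=> 0).
Proof.
apply: funext => k; case: (ltnP k 30) => k30; first by rewrite disp_diff // subrr.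
by rewrite /disp ltnNge k30.
Qed.

(** Nonnegative coefficients on 1 and phi suffice for a nonnegative gap. As [edot] of two directions
    is 48 times the cosine of their angle, the bound 47 excludes parallel lines. *)
Definition Cm_pair_apart (p : nat * nat) :=
  let c := (jet_of (egap p.1 p.2)).1.1 in
  [&& Z.leb 0 c.1, Z.leb 0 c.2 & zsmall 47 (jet_of (edot (edir p.1) (edir p.2))).1.1].

Lemma Cm_pairs_apart : all Cm_pair_apart [seq (i, j) | i <- iota 0 6, j <- iota i.+1 (5 - i)].
Proof. by vm_compute. Qed.

Lemma Zr47 : Zr R 47%ZZ = 47.
Proof. by rewrite Zr_pos; congr (_%:R); lia. Qed.

Lemma far_pair i j : (i < j < 6)%N ->
  0 < dot (normal (Cm_pair R i) (Cm_pair R j)) (normal (Cm_pair R i) (Cm_pair R j)) /\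
  12 / 11 * dot (normal (Cm_pair R i) (Cm_pair R j)) (normal (Cm_pair R i) (Cm_pair R j))
    <= offset (Cm_pair R i) (Cm_pair R j) ^+ 2.
Proof.
move=> /andP[ij j6]; have i6 := ltn_trans ij j6.
have an : anchored (Cm_pair R) by exact: anchoredP.
have ev e : zval R (jet_of e).1.1 = eval (disp (Cm_pair R)) e by rewrite disp_Cm_pair eval0.
have /and3P[/Z.leb_le c1 /Z.leb_le c2 q47] : Cm_pair_apart (i, j).
  by apply: (allP Cm_pairs_apart); apply: allpairs_f_dep; rewrite mem_iota //; lia.
split.
  have {q47} : `|48 * dot (dir (Cm_pair R i)) (dir (Cm_pair R j))| <= Zr R 47%ZZ.
    by rewrite -(eval_dir an i6 j6) -ev; apply: zsmallP q47.
  rewrite dot_normal Zr47 -real_normK ?num_real //; move: (dot _ _) => q.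
  rewrite normrM ger0_norm ?ler0n // => q47.
  have q1 : `|q| < 1 by lra.
  by rewrite subr_gt0 expr_lt1.
rewrite -subr_ge0 -(pmulr_rge0 _ (ltr0n R 8448)) -(eval_gap an i6 j6) -ev /zval.
apply: addr_ge0; first exact: (Zr_le R c1).
apply: mulr_ge0; first exact: (Zr_le R c2).
by have := golden_gt1 R; lra.
Qed.

(* The square of a triple product is a Gram determinant, hence invariant under
   rotations. *)
Lemma dot_triple (w a b : 'cV[R]_3) : dot w (cross a b) ^+ 2 =
  dot w w * (dot a a * dot b b - dot a b ^+ 2)
  - dot w a * (dot w a * dot b b - dot w b * dot a b)
  + dot w b * (dot w a * dot a b - dot w b * dot a a).
Proof. by rewrite !dotE !(vec3E, mxE) /=; ring. Qed.

Lemma offset_rotate (g : SO3 R) u v :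
  offset (rotate_pair g u) (rotate_pair g v) ^+ 2 = offset u v ^+ 2.
Proof.
rewrite /offset /normal !dot_triple !base_rotate !dir_rotate -mulmxBr.
by rewrite !dot_SO3.
Qed.

Lemma normal_rotate (g : SO3 R) u v :
  dot (normal (rotate_pair g u) (rotate_pair g v)) (normal (rotate_pair g u) (rotate_pair g v))
  = dot (normal u v) (normal u v).
Proof. by rewrite !dot_normal !dir_rotate dot_SO3. Qed.

End Configurations.

(** * The value of [D] at [C_m] and the strict local maximum *)

Lemma D_le (R : realType) (m : M6 R) (i j : 'I_6) : (i < j)%N ->
  D m <= line_dist (m i) (m j).
Proof.
exact: (@bigmin_le_cond _ _ _ _ (i, j) (fun p => (p.1 < p.2)%N)
          (fun p => line_dist (m p.1) (m p.2))).
Qed.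

(** No pair is closer than the bound, by [far_pair], and the pair (0, 1) attains it because its gap
    is exactly zero. *)
Lemma D_C_m (R : realType) : Num.sqrt (12 / 11) = D (C_m R).
Proof.
set s := Num.sqrt _; have s0 : 0 <= s := sqrtr_ge0 _.
have s2 : s ^+ 2 = 12 / 11 by rewrite sqr_sqrtr //; lra.
have far (i j : 'I_6) : (i < j)%N -> s <= line_dist (C_m R i) (C_m R j).
  move=> ij; rewrite !C_mE; have [|n0 H] := @far_pair R i j; first by rewrite ij /=.
  by apply: le_line_dist => //; rewrite s2.
have near : line_dist (C_m R 0) (C_m R 1) <= s.
  have d0 := far 0 1 isT; rewrite !C_mE in d0 *.
  have [n0 _] := @far_pair R 0 1 isT.
  have := line_dist_le (le_trans s0 d0) (lexx _).
  have -> : offset (Cm_pair R 0) (Cm_pair R 1) ^+ 2 =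
      s ^+ 2 * dot (normal (Cm_pair R 0) (Cm_pair R 1)) (normal (Cm_pair R 0) (Cm_pair R 1)).
    have an : anchored (Cm_pair R) by exact: anchoredP.
    have z : zgold0 (jet_of (egap 0 1)).1.1 by vm_compute.
    have := eval_gap an (isT : 0 < 6)%N (isT : 1 < 6)%N.
    rewrite disp_Cm_pair eval0 (zgold0P R z) s2 => /esym/eqP.
    by rewrite mulf_eq0 pnatr_eq0 subr_eq0 /= => /eqP.
  by rewrite (ler_pM2r n0) ler_pXn2r ?nnegrE // (le_trans s0 d0).
apply/le_anti/andP; split; last by apply: le_trans near; exact: D_le.
(* The seed of the minimum is the distance of the pair (0, 1), hence satisfies the same bound. *)
by apply/bigmin_geP; split=> [|[i j] /= ij]; apply: far.
Qed.

Theorem theorem1 (R : realType) :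
  Num.sqrt (12 / 11) = D (C_m R) /\
  exists U : set (M6 R),
    nbhs (C_m R) U /\
    forall m : M6 R, U m ->
      ~ (exists g : SO3 R, m = rotate6 g (C_m R)) ->
      D m < Num.sqrt (12 / 11).
Proof.
split; first exact: D_C_m.
have [d d0 rig] := rigid R.
(* Here 259 = 7 * 37: the rotation moves coordinates by at most [36 * e], the initial deviation adds
   [e], and [line_coord] multiplies by at most 7. *)
pose e := d / 259; have e0 : 0 < e by rewrite divr_gt0.
exists [set m | forall i : 'I_6, line_nbhs e (Cm_pair R i) (m i)]; split.
  have -> : C_m R = (fun i => to_line (Cm_pair R i)) by apply: funext => i; exact: C_mE.
  exact: nbhs_lines.
move=> m near notrot; rewrite ltNge; apply/negP => far; apply: notrot.
(* Of the two orientations of each line, one close to that of [Cm_pair] is selected. *)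
have /choice[u uP] (i : 'I_6) :
    exists v : UTS2 R, m i = to_line v /\ near_line e v (Cm_pair R i).
  by have [v] := near i; exists v.
pose c0 := Cm_pair R 0.
(* The rotation [g] puts the first line back exactly in its place; [g'] is its inverse. *)
pose g : SO3 R := exist _ (carry (u 0) c0) (carry_SO3 (u 0) c0).
pose g' : SO3 R := exist _ (carry c0 (u 0)) (carry_SO3 c0 (u 0)).
pose y (k : nat) := rotate_pair g (u (inord k)).
have y0 : y 0%N = c0.
  rewrite /y (_ : inord 0 = 0); last by apply: val_inj; rewrite /= inordK.
  by apply: UTS2P; [exact: carry_base | exact: carry_dir].
have rot_near p q i : dot p p = 1 -> (forall i, `|p i 0 - q i 0| < e) ->
    `|(carry (u 0) c0 *m p) i 0 - q i 0| <= 37 * e.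
  move=> p1 /(_ i) /ltW pq; have pm := carry_near i (uP 0).2 p1.
  by move: pm pq; rewrite !ler_norml => /andP[? ?] /andP[? ?]; lra.
have small k : `|disp y k| <= d.
  case: (ltnP k 30) => k30; last by rewrite /disp ltnNge k30 normr0 ltW.
  have -> : d = 7 * (37 * e) by rewrite /e; field.
  have k6 : ((k + 6) %/ 6 < 6)%N by lia.
  rewrite disp_diff //; apply: line_coord_near => i.
    apply: rot_near; first exact: base_unit.
    by move=> j; have := (uP (inord ((k + 6) %/ 6))).2 j; rewrite inordK // => -[].
  apply: rot_near; first exact: dir_unit.
  by move=> j; have := (uP (inord ((k + 6) %/ 6))).2 j; rewrite inordK // => -[].
have apart i j : (i < j < 6)%N ->
    12 / 11 * dot (normal (y i) (y j)) (normal (y i) (y j)) <= offset (y i) (y j) ^+ 2.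
  move=> /andP[ij j6]; have i6 := ltn_trans ij j6.
  rewrite /y offset_rotate normal_rotate.
  have -> : 12 / 11 = Num.sqrt (12 / 11) ^+ 2 :> R by rewrite sqr_sqrtr //; lra.
  apply: line_dist_le; first exact: sqrtr_ge0.
  rewrite -!(proj1 (uP _)); apply: le_trans far _.
  by apply: D_le; rewrite !inordK.
have yE := disp_eq0 y0 (rig y (anchoredP y0) small apart).
(* The rotated configuration coincides with [C_m], so undoing [g] exhibits [m] as a rotated copy. *)
exists g'; apply: funext => i; rewrite /rotate6 C_mE rotate_to_line (uP i).1.
congr to_line; have := yE i (ltn_ord i); rewrite /y inord_val => <-.
by apply: UTS2P; rewrite !(base_rotate, dir_rotate) /= mulmxA carryK mul1mx.
Qed.
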